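(* Let $G=(V,\mathcal E,w)$ be an undirected, connected, weighted graph on $n$ nodes with Laplacian $L$ and largest Laplacian eigenvalue $\lambda_n$. Let $\tau\ge0$ with $\tau\lambda_n<\pi/2$. Consider the consensus network with sensor noise $$\dot x(t)=-L\,x(t-\tau)+L\,\xi(t),\qquad y=M_nx,$$ where $\xi_1,\dots,\xi_n$ are mutually independent zero-mean Gaussian white noises with intensities $\sigma_1^2,\dots,\sigma_n^2$. This corresponds to the agent update $$\dot x_i=\sum_{j\ne i}a_{ij}\big((x_j(t-\tau)+\xi_j(t))-(x_i(t-\tau)+\xi_i(t))\big).$$ Then for every agent $i\in V$ the centrality index is $$\eta_i=\frac12\Big[L\cos(\tau L)\big(M_n-\sin(\tau L)\big)^{\dagger}\Big]_{ii}.$$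
   Context: Notation: - $a_{ij}$ are the weighted adjacency entries. - $M_n=I_n-\frac1n\mathbf1\mathbf1^T$. - $X^\dagger$ is the Moore–Penrose pseudo-inverse. - $\cos(X)$ and $\sin(X)$ are the matrix power-series functions. The performance is $$\rho_{ss}=\lim_{t\to\infty}\mathbb E[y^Ty]=\frac1{2\pi}\int_{-\infty}^{\infty}\mathrm{Tr}[G(j\omega)^HG(j\omega)]d\omega,\qquad G(s)=M_n(sI+e^{-\tau s}L)^{-1}L\,\mathrm{diag}(\sigma_1,\dots,\sigma_n).$$ The centrality index is $\eta_i=\partial\rho_{ss}/\partial\sigma_i^2$. *)

(* Defs.v *)
From HB Require Import structures.
From mathcomp Require Import all_boot all_order all_algebra.
From mathcomp Require Import all_classical all_reals all_analysis.
From mathcomp Require Import complex.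

Set Implicit Arguments.
Unset Strict Implicit.
Unset Printing Implicit Defensive.

Import Order.TTheory GRing.Theory Num.Theory.
Local Open Scope ring_scope.

Definition undirected_weighted_graph (R : realType) (n : nat) (A : 'M[R]_n) : Prop :=
  [/\ forall i j, A i j = A j i,
      forall i j, 0 <= A i j
    & forall i, A i i = 0].

Definition connected_graph (R : realType) (n : nat) (A : 'M[R]_n) : Prop :=
  forall i j : 'I_n, connect (fun u v : 'I_n => 0 < A u v) i j.

Definition laplacian (R : realType) (n : nat) (A : 'M[R]_n) : 'M[R]_n :=
  \matrix_(i, j) ((i == j)%:R * (\sum_(k < n) A i k) - A i j).

Definition centering (R : realType) (n : nat) : 'M[R]_n :=
  1%:M - (n%:R)^-1 *: const_mx 1.

Definition mx_series (R : realType) (n : nat) (c : nat -> R) (X : 'M[R]_n)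
  : 'M[R]_n :=
  \matrix_(i, j) limn (fun N : nat => ((\sum_(k < N) c k *: X ^+ k) i j : R^o)).

Definition cosmx (R : realType) (n : nat) (X : 'M[R]_n) : 'M[R]_n :=
  mx_series (fun k => if odd k then 0 else (-1) ^+ k./2 / (k`!)%:R) X.

Definition sinmx (R : realType) (n : nat) (X : 'M[R]_n) : 'M[R]_n :=
  mx_series (fun k => if odd k then (-1) ^+ k./2 / (k`!)%:R else 0) X.

(** Moore-Penrose conditions (real matrices, so ^H = ^T). *)
Definition is_MP_inverse (R : realType) (n : nat) (X Y : 'M[R]_n) : Prop :=
  [/\ X *m Y *m X = X, Y *m X *m Y = Y, (X *m Y)^T = X *m Y
    & (Y *m X)^T = Y *m X].

(** Moore-Penrose pseudo-inverse X^dagger (the unique Y satisfying the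
    Penrose conditions). *)
Definition mp_pinv (R : realType) (n : nat) (X : 'M[R]_n) : 'M[R]_n :=
  xget 0 (is_MP_inverse X).

Definition expj (R : realType) (t : R) : R[i] := Complex (cos t) (sin t).

Definition cmx (R : realType) (n : nat) (X : 'M[R]_n) : 'M[R[i]]_n :=
  map_mx (fun x : R => Complex x 0) X.

Definition transfer_jw (R : realType) (n : nat) (L : 'M[R]_n) (tau : R)
  (sigma : 'I_n -> R) (w : R) : 'M[R[i]]_n :=
  cmx (centering R n)
    *m invmx (Complex 0 w *: 1%:M + expj (- (tau * w)) *: cmx L)
    *m cmx L
    *m diag_mx (\row_k Complex (sigma k) 0).

(** Tr[G^H G] (a real number; we take its real part). *)
Definition trGHG (R : realType) (n : nat) (G : 'M[R[i]]_n) : R :=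
  @complex.Re R (\tr ((map_mx (@conjc R) G)^T *m G)).

Definition rho_ss (R : realType) (n : nat) (L : 'M[R]_n) (tau : R)
  (sigma : 'I_n -> R) : R :=
  (2 * pi)^-1 *
  fine (\int[@lebesgue_measure R]_(w in [set: R])
          (trGHG (transfer_jw L tau sigma w))%:E)%E.

(** rho_ss as a function of the intensities sigma_k^2 (sigma_k >= 0). *)
Definition rho_ss_var (R : realType) (n : nat) (L : 'M[R]_n) (tau : R)
  (v : 'I_n -> R) : R :=
  rho_ss L tau (fun k => Num.sqrt (v k)).

(* Main.v *)
Require Import Defs.
From HB Require Import structures.
From mathcomp Require Import all_boot all_order all_algebra.
From mathcomp Require Import all_classical all_reals all_analysis.
From mathcomp Require Import complex.
From mathcomp Require Import ring lra measurable_realfun spectral.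
Set Implicit Arguments.
Unset Strict Implicit.
Unset Printing Implicit Defensive.
Import Order.TTheory GRing.Theory Num.Theory.
Import numFieldNormedType.Exports.
Local Open Scope ring_scope.
Local Open Scope complex_scope.
Local Open Scope classical_set_scope.
Local Notation Re := complex.Re.
Local Notation Im := complex.Im.
Local Notation normc := Normc.normc.

(**
Diagonalizing [L] makes [Tr (G^H G)] a linear combination of the intensities
whose coefficients are combinations of the modal gains
[lam^2 / |jw + lam e^(-j tau w)|^2], so everything rests on the scalar integral,
scaled to [lam = 1] with [a = tau * lam]:
[∫ du / (1 + u^2 - 2 u sin (a u)) = pi * cos a / (1 - sin a)].

With [p(z) = z + e^(-a z)], which has no zero in the closed right half-plane when
[a < pi / 2], the function [h = (e^(-a z) - z) / p] is holomorphic there and on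
the imaginary axis has real part [(1 - u^2) / |p(iu)|^2].  Put
[c = cos a / (1 - sin a)]; since [h(± i) = ∓ i c], the function
[g = (h + c (z - 1) / (z + 1)) / (1 + z^2)] has removable singularities at [± i] and
is [O(|z|^-2)] on the half-plane, while [Re g(iu) = 1 / |p(iu)|^2 - c / (1 + u^2)].
By the Cauchy-Riemann equations the integral of [Re g] over a vertical segment
[x + i[-T, T]] varies with [x] only through boundary terms that vanish as
[T] grows; pushing [x] to infinity and to [0] gives [∫ Re g(iu) du = 0].
*)

(** * Complex-valued curves *)

Section ComplexModulus.
Variable R : realType.
Implicit Types z w : R[i].

Lemma normcE2 z : normc z = Num.sqrt (Re z ^+ 2 + Im z ^+ 2).
Proof. by case: z. Qed.

Lemma normc_sqr z : normc z ^+ 2 = Re z ^+ 2 + Im z ^+ 2.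
Proof. by rewrite normcE2 sqr_sqrtr// addr_ge0 ?sqr_ge0. Qed.

Lemma normc_ge0 z : 0 <= normc z.
Proof. by rewrite normcE2 sqrtr_ge0. Qed.

Lemma normc_triangle z w : normc (z + w) <= normc z + normc w.
Proof. exact: le_normcD. Qed.

Lemma normc_opp z : normc (- z) = normc z.
Proof. exact: normcN. Qed.

Lemma normc_subr z w : normc (z - w) = normc (w - z).
Proof. by rewrite -normc_opp opprB. Qed.

Lemma normc_tri_sub z w : normc z - normc w <= normc (z - w).
Proof. by rewrite lerBlDr; apply: le_trans (normc_triangle _ _); rewrite subrK. Qed.

Lemma normr_Re_le z : `|Re z| <= normc z.
Proof. by rewrite normcE2 -sqrtr_sqr ler_wsqrtr// lerDl sqr_ge0. Qed.

Lemma normr_Im_le z : `|Im z| <= normc z.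
Proof. by rewrite normcE2 -sqrtr_sqr ler_wsqrtr// lerDr sqr_ge0. Qed.

Lemma normc_gt0 z : (0 < normc z) = (z != 0).
Proof.
rewrite lt0r normc_ge0 andbT; congr (~~ _).
by apply/eqP/eqP => [/Normc.eq0_normc //|->]; exact: Normc.normc0.
Qed.

Lemma normc_le_ReIm z : normc z <= `|Re z| + `|Im z|.
Proof.
rewrite -(@ler_pXn2r _ 2)// ?nnegrE ?addr_ge0 ?normc_ge0//.
rewrite normc_sqr -(real_normK (num_real (Re z))) -(real_normK (num_real (Im z))).
have := normr_ge0 (Re z); have := normr_ge0 (Im z); nra.
Qed.

End ComplexModulus.

Section ComplexCurves.
Variable R : realType.
Implicit Types (f g : R -> R[i]) (t : R) (d e : R[i]).

(** Curves have a real parameter, so differentiating the two components separately reduces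
    everything to real calculus; complex differentiability is recovered below by combining
    horizontal and vertical curves. *)
Definition cderive f t d :=
  is_derive t (1 : R) (fun s => Re (f s)) (Re d) /\
  is_derive t (1 : R) (fun s => Im (f s)) (Im d).

Definition ccont f t :=
  {for t, continuous (fun s => Re (f s))} /\
  {for t, continuous (fun s => Im (f s))}.

Lemma cderive_cst (k : R[i]) t : cderive (fun=> k) t 0.
Proof. by split; exact: is_derive_cst. Qed.

Lemma cderiveD f g t d e :
  cderive f t d -> cderive g t e -> cderive (fun s => f s + g s) t (d + e).
Proof.
case: d e => [d1 d2] [e1 e2] [f1 f2] [g1 g2]; split.
- rewrite (_ : (fun _ => _) = (fun s => Re (f s)) + (fun s => Re (g s))).
    exact: is_deriveD.
  by apply/funext => s; rewrite !fctE; case: (f s) (g s) => ? ? [].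
- rewrite (_ : (fun _ => _) = (fun s => Im (f s)) + (fun s => Im (g s))).
    exact: is_deriveD.
  by apply/funext => s; rewrite !fctE; case: (f s) (g s) => ? ? [].
Qed.

Lemma cderiveM f g t d e :
  cderive f t d -> cderive g t e ->
  cderive (fun s => f s * g s) t (d * g t + f t * e).
Proof.
move=> [f1 f2] [g1 g2]; split.
- rewrite (_ : (fun _ => _) = (fun s => Re (f s)) * (fun s => Re (g s))
                            - (fun s => Im (f s)) * (fun s => Im (g s))).
    apply: is_derive_eq; rewrite /GRing.scale/=.
    by case: d e (f t) (g t) {f1 f2 g1 g2} => [? ?] [? ?] [? ?] [? ?] /=; ring.
  by apply/funext => s; rewrite !fctE; case: (f s) (g s) => ? ? [].
- rewrite (_ : (fun _ => _) = (fun s => Re (f s)) * (fun s => Im (g s))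
                            + (fun s => Im (f s)) * (fun s => Re (g s))).
    apply: is_derive_eq; rewrite /GRing.scale/=.
    by case: d e (f t) (g t) {f1 f2 g1 g2} => [? ?] [? ?] [? ?] [? ?] /=; ring.
  by apply/funext => s; rewrite !fctE; case: (f s) (g s) => ? ? [].
Qed.

Lemma cderiveV f t d :
  f t != 0 -> cderive f t d ->
  cderive (fun s => (f s)^-1) t (- (d * (f t)^-1 * (f t)^-1)).
Proof.
move=> ft0 [f1 f2].
have n0 : Re (f t) ^+ 2 + Im (f t) ^+ 2 != 0.
  by rewrite -normc_sqr sqrf_eq0 gt_eqF// normc_gt0.
(* The inverse is the conjugate divided by the squared modulus [N]. *)
pose N := (fun s => Re (f s)) * (fun s => Re (f s))
        + (fun s => Im (f s)) * (fun s => Im (f s)).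
have NE s : N s = Re (f s) ^+ 2 + Im (f s) ^+ 2 by rewrite !expr2.
have dN : is_derive t (1 : R) N (2 * (Re (f t) * Re d + Im (f t) * Im d)).
  by apply: is_derive_eq; rewrite /GRing.scale/=; ring.
have N0 : N t != 0 by rewrite NE.
have dNV := is_deriveV N0 dN.
split.
- rewrite (_ : (fun _ => _) = (fun s => Re (f s)) * (fun s => (N s)^-1)).
    apply: is_derive_eq; rewrite /GRing.scale/= NE.
    by case: d (f t) n0 {f1 f2 ft0 N0 dN dNV} => [? ?] [? ?] /= n0; field.
  by apply/funext => s; rewrite !fctE NE; case: (f s).
- rewrite (_ : (fun _ => _) = - ((fun s => Im (f s)) * (fun s => (N s)^-1))).
    apply: is_derive_eq; rewrite /GRing.scale/= NE.
    by case: d (f t) n0 {f1 f2 ft0 N0 dN dNV} => [? ?] [? ?] /= n0; field.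
  by apply/funext => s; rewrite !fctE NE; case: (f s).
Qed.

Lemma cderive_ccont f t d : cderive f t d -> ccont f t.
Proof.
by move=> [[f1 _] [f2 _]]; split; apply: differentiable_continuous;
  apply/derivable1_diffP.
Qed.

Lemma ccont_cst (k : R[i]) t : ccont (fun=> k) t.
Proof. by split; exact: cst_continuous. Qed.

Lemma ccontD f g t : ccont f t -> ccont g t -> ccont (fun s => f s + g s) t.
Proof.
move=> [f1 f2] [g1 g2]; split.
- rewrite (_ : (fun _ => _) = (fun s => Re (f s)) + (fun s => Re (g s))).
    exact: continuousD.
  by apply/funext => s; rewrite !fctE; case: (f s) (g s) => ? ? [].
- rewrite (_ : (fun _ => _) = (fun s => Im (f s)) + (fun s => Im (g s))).
    exact: continuousD.
  by apply/funext => s; rewrite !fctE; case: (f s) (g s) => ? ? [].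
Qed.

Lemma ccontM f g t : ccont f t -> ccont g t -> ccont (fun s => f s * g s) t.
Proof.
move=> [f1 f2] [g1 g2]; split.
- rewrite (_ : (fun _ => _) = (fun s => Re (f s) * Re (g s))
                            - (fun s => Im (f s) * Im (g s))).
    by apply: continuousB; exact: continuousM.
  by apply/funext => s; rewrite !fctE; case: (f s) (g s) => ? ? [].
- rewrite (_ : (fun _ => _) = (fun s => Re (f s) * Im (g s))
                            + (fun s => Im (f s) * Re (g s))).
    by apply: continuousD; exact: continuousM.
  by apply/funext => s; rewrite !fctE; case: (f s) (g s) => ? ? [].
Qed.

Lemma ccontV f t : f t != 0 -> ccont f t -> ccont (fun s => (f s)^-1) t.
Proof.
move=> ft0 [f1 f2].
have n0 : Re (f t) * Re (f t) + Im (f t) * Im (f t) != 0.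
  by rewrite -!expr2 -normc_sqr sqrf_eq0 gt_eqF// normc_gt0.
have cN : {for t, continuous (fun s => (Re (f s) * Re (f s) + Im (f s) * Im (f s))^-1)}.
  by apply: continuousV => //; apply: continuousD; exact: continuousM.
split.
- rewrite (_ : (fun _ => _) = (fun s =>
    Re (f s) * (Re (f s) * Re (f s) + Im (f s) * Im (f s))^-1)).
    exact: continuousM.
  by apply/funext => s; rewrite -!expr2; case: (f s).
- rewrite (_ : (fun _ => _) = - (fun s =>
    Im (f s) * (Re (f s) * Re (f s) + Im (f s) * Im (f s))^-1)).
    by apply: continuousN; exact: continuousM.
  by apply/funext => s; rewrite !fctE -!expr2; case: (f s).
Qed.

End ComplexCurves.

(** * Holomorphy on half-planes and contour shift *)

Section HalfPlaneHolomorphy.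
Variable R : realType.
Implicit Types (F G : R[i] -> R[i]) (r x y : R).

(** The same [F'] serves horizontally and, multiplied by ['i], vertically: these are the
    Cauchy-Riemann equations. Continuity of [F'] on vertical lines is what the fundamental theorem
    of calculus asks for, and the bound [B] is the dominating constant for differentiation under the
    integral sign. *)
Definition holo_bdd_deriv r F := exists (F' : R[i] -> R[i]) (B : R),
  forall x y, r < x ->
  [/\ cderive (fun s => F (s +i* y)) x (F' (x +i* y)),
      cderive (fun s => F (x +i* s)) y ('i * F' (x +i* y)),
      ccont (fun s => F' (x +i* s)) y
    & normc (F' (x +i* y)) <= B].

Definition bdd_on_half_plane r F := exists B : R,
  forall x y, r < x -> normc (F (x +i* y)) <= B.

Lemma holo_bdd_deriv_cst r (k : R[i]) : holo_bdd_deriv r (fun=> k).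
Proof.
exists (fun=> 0), 0 => x y rx; split.
- exact: cderive_cst.
- by rewrite mulr0; exact: cderive_cst.
- exact: ccont_cst.
- by rewrite Normc.normc0.
Qed.

Lemma holo_bdd_deriv_id r : holo_bdd_deriv r id.
Proof.
exists (fun=> 1), 1 => x y rx; split.
- split; first exact: is_derive_id.
  exact: is_derive_cst.
- rewrite mulr1; split; first exact: is_derive_cst.
  exact: is_derive_id.
- exact: ccont_cst.
- by rewrite Normc.normc1.
Qed.

Lemma holo_bdd_derivD r F G : holo_bdd_deriv r F -> holo_bdd_deriv r G ->
  holo_bdd_deriv r (fun z => F z + G z).
Proof.
move=> [F' [B FP]] [G' [C GP]].
exists (fun z => F' z + G' z), (B + C) => x y rx.
have [F1 F2 F3 F4] := FP x y rx; have [G1 G2 G3 G4] := GP x y rx; split.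
- exact: cderiveD.
- by rewrite mulrDr; exact: cderiveD.
- exact: ccontD.
- by apply: le_trans (normc_triangle _ _) _; exact: lerD.
Qed.

Lemma holo_bdd_derivM r F G :
  holo_bdd_deriv r F -> bdd_on_half_plane r F ->
  holo_bdd_deriv r G -> bdd_on_half_plane r G ->
  holo_bdd_deriv r (fun z => F z * G z).
Proof.
move=> [F' [B FP]] [bF bFP] [G' [C GP]] [bG bGP].
exists (fun z => F' z * G z + F z * G' z), (B * bG + bF * C) => x y rx.
have [F1 F2 F3 F4] := FP x y rx; have [G1 G2 G3 G4] := GP x y rx; split.
- exact: cderiveM.
- by rewrite mulrDr mulrA [_ * (F _ * _)]mulrCA; exact: cderiveM.
- by apply: ccontD; apply: ccontM => //;
    [exact: cderive_ccont G2|exact: cderive_ccont F2].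
- apply: le_trans (normc_triangle _ _) _; rewrite !Normc.normcM.
  by apply: lerD; apply: ler_pM => //; rewrite ?normc_ge0// ?bFP ?bGP.
Qed.

Lemma holo_bdd_derivV r F (e : R) : 0 < e ->
  (forall x y, r < x -> e <= normc (F (x +i* y))) ->
  holo_bdd_deriv r F -> holo_bdd_deriv r (fun z => (F z)^-1).
Proof.
move=> e0 eF [F' [B FP]].
exists (fun z => - (F' z * (F z)^-1 * (F z)^-1)), (B * e^-1 * e^-1) => x y rx.
have [F1 F2 F3 F4] := FP x y rx.
have FxyG := lt_le_trans e0 (eF x y rx).
have F0 : F (x +i* y) != 0 by rewrite -normc_gt0.
have cFV : ccont (fun s => (F (x +i* s))^-1) y.
  by apply: ccontV => //; exact: cderive_ccont F2.
split.
- exact: cderiveV.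
- by rewrite mulrN !mulrA; exact: cderiveV.
- rewrite (_ : (fun _ => _) = (fun s => (- 1) * (F' (x +i* s) * (F (x +i* s))^-1
     * (F (x +i* s))^-1))); last by apply/funext => s; rewrite mulN1r.
  by apply: ccontM (ccont_cst _ _) _; apply: ccontM => //; exact: ccontM.
- rewrite normc_opp !Normc.normcM Normc.normcV.
  have FV : (normc (F (x +i* y)))^-1 <= e^-1.
    by rewrite lef_pV2 ?posrE// eF.
  by rewrite !ler_pM ?mulr_ge0 ?invr_ge0 ?normc_ge0.
Qed.

Lemma bdd_on_half_planeV r F (e : R) : 0 < e ->
  (forall x y, r < x -> e <= normc (F (x +i* y))) ->
  bdd_on_half_plane r (fun z => (F z)^-1).
Proof.
move=> e0 eF; exists e^-1 => x y rx.
by rewrite Normc.normcV lef_pV2 ?posrE ?eF// (lt_le_trans e0) ?eF.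
Qed.

Lemma bdd_on_half_planeM r F G : bdd_on_half_plane r F ->
  bdd_on_half_plane r G -> bdd_on_half_plane r (fun z => F z * G z).
Proof.
move=> [B FB] [C GC]; exists (B * C) => x y rx.
by rewrite Normc.normcM ler_pM ?normc_ge0 ?FB ?GC.
Qed.

Lemma bdd_on_half_plane_cst r (k : R[i]) : bdd_on_half_plane r (fun=> k).
Proof. by exists (normc k). Qed.

End HalfPlaneHolomorphy.

(** * Integrals over vertical segments and their dependence on the abscissa *)

Section ContourShift.
Variable R : realType.
Let mu := @lebesgue_measure R.
Implicit Types (r s x y T : R).
Variables (F : R[i] -> R[i]) (C : R).
Hypothesis holF : forall r, 0 < r -> holo_bdd_deriv r F.
Hypothesis FC : forall x y, 0 < x -> normc (F (x +i* y)) <= C / (1 + x ^+ 2 + y ^+ 2).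

Lemma cont_vertical x : 0 < x -> continuous (fun y : R => Re (F (x +i* y))).
Proof.
move=> x0 y; have [F' [B FP]] := holF (divr_gt0 x0 (ltr0Sn _ 1)).
have [|_ F2 _ _] := FP x y; first by lra.
by have [] := cderive_ccont F2.
Qed.

(** Differentiating under the integral sign yields the integral of [Re F']. By Cauchy-Riemann,
    [Re F'] is the [y]-derivative of [Im F], so only the values of [Im F] at [y = T] and [y = - T]
    remain, and the decay of [F] bounds each by [C / (1 + T ^+ 2)]. *)
Lemma integral_vertical_derive (T x : R) : 0 < T -> 0 < x ->
  exists d : R,
  is_derive x (1:R) (fun s => \int[mu]_(y in `[(- T), T]) Re (F (s +i* y)))%R d /\
  `|d| <= 2 * C / (1 + T ^+ 2).
Proof.
move=> T0 x0.
have x20 : 0 < x / 2 by rewrite divr_gt0.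
have [F' [B FP]] := holF x20.
have NTT : - T < T by lra.
have d1E s y : x / 2 < s ->
  partial1of2 (fun s y => Re (F (s +i* y))) s y = Re (F' (s +i* y)).
  move=> xs; have [[F1 _] _ _ _] := FP s y xs.
  by rewrite partial1of2E derive_val.
(* A neighbourhood of [x] that stays at distance [x / 2] from the imaginary axis, where a single [B]
   bounds [F']. *)
have Ix : `]x / 2, (x + 1)%R[%classic x by rewrite /= in_itv/=; lra.
have intf s : `]x / 2, (x + 1)%R[%classic s ->
    mu.-integrable `[(- T), T] (EFin \o (fun y => Re (F (s +i* y)))).
  rewrite /= in_itv/= => /andP[xs _].
  apply: continuous_compact_integrable; first exact: segment_compact.
  apply: continuous_subspaceT; apply: cont_vertical; lra.
have derf s y : `]x / 2, (x + 1)%R[%classic s -> `[(- T), T]%classic y ->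
    derivable (fun s => Re (F (s +i* y))) s 1.
  rewrite /= in_itv/= => /andP[xs _] _.
  by have [[F1 _] _ _ _] := FP s y xs; exact: ex_derive.
have intB : mu.-integrable `[(- T), T] (EFin \o (fun=> `|B|)).
  apply: continuous_compact_integrable; first exact: segment_compact.
  by apply: continuous_subspaceT; exact: cst_continuous.
have ubB s y : `]x / 2, (x + 1)%R[%classic s -> `[(- T), T]%classic y ->
    `|partial1of2 (fun s y => Re (F (s +i* y))) s y| <= `|B|.
  rewrite /= in_itv/= => /andP[xs _] _; rewrite d1E//.
  have [_ _ _ F4] := FP s y xs.
  apply: le_trans (normr_Re_le _) _; apply: le_trans F4 _; exact: ler_norm.
have mI : measurable (`[(- T), T] : set (measurableTypeR R)) by [].
have dS := derivable_under_integral mI Ix intf derf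
   (fun=> normr_ge0 B) intB ubB.
have dSE := differentiation_under_integral mI Ix intf derf
   (fun=> normr_ge0 B) intB ubB.
exists (Im (F (x +i* T)) - Im (F (x +i* (- T)))); split; last first.
  have b1 y : y ^+ 2 = T ^+ 2 -> `|Im (F (x +i* y))| <= C / (1 + T ^+ 2).
    move=> yT; apply: le_trans (normr_Im_le _) _; apply: le_trans (FC _ x0) _.
    have C0 : 0 <= C.
      have := le_trans (normc_ge0 _) (FC y x0).
      by rewrite pmulr_lge0// invr_gt0 yT; nra.
    by rewrite ler_wpM2l// lef_pV2 ?posrE; nra.
  apply: le_trans (ler_normB _ _) _.
  rewrite -mulrA mulr_natl mulr2n; apply: lerD; exact: b1 (erefl _) || apply: b1.
  by rewrite sqrrN.
apply: DeriveDef => //.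
rewrite -derive1E dSE /Rintegral.
have xx : x / 2 < x by lra.
under eq_integral => y _ do rewrite d1E//.
rewrite (@continuous_FTC2 _ (fun y => Re (F' (x +i* y))) (fun y => Im (F (x +i* y)))) //.
- apply: continuous_subspaceT => y.
  by have [|_ _ [F3 _] _] := FP x y; first lra.
- have dI y : derivable (fun y => Im (F (x +i* y))) y 1.
    by have [|_ [_ F2] _ _] := FP x y; first lra; exact: ex_derive.
  split.
  + by move=> y _.
  + apply: cvg_at_right_filter; apply: differentiable_continuous.
    exact/derivable1_diffP.
  + apply: cvg_at_left_filter; apply: differentiable_continuous.
    exact/derivable1_diffP.
- move=> y _; have [|_ [_ F2] _ _] := FP x y; first lra.
  rewrite derive1E derive_val.
  by case: (F' (x +i* y)) => a b /=; ring.
Qed.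

(** The segment is compared with the one at abscissa [T]. There the integrand is at most
    [C / (1 + T ^+ 2)] over a length [2 * T]; moving from [T] back to [r] costs at most [T] times
    the derivative bound. The two contributions are equal. *)
Lemma integral_vertical_bound (T r : R) : 0 < r -> r <= T ->
  `|\int[mu]_(y in `[(- T), T]) Re (F (r +i* y))|%R <= 4 * C * T / (1 + T ^+ 2).
Proof.
move=> r0 rT; have T0 : 0 < T by lra.
pose S s := (\int[mu]_(y in `[(- T), T]) Re (F (s +i* y)))%R.
have T2 : 0 < 1 + T ^+ 2 by nra.
have C0 : 0 <= C.
  have := le_trans (normc_ge0 _) (FC 0 r0).
  by rewrite pmulr_lge0// invr_gt0; nra.
have mI : measurable (`[(- T), T] : set (measurableTypeR R)) by [].
have ST : `|S T| <= 2 * C * T / (1 + T ^+ 2).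
  have iF : mu.-integrable `[(- T), T] (EFin \o (fun y => Re (F (T +i* y)))).
    apply: continuous_compact_integrable; first exact: segment_compact.
    by apply: continuous_subspaceT; exact: cont_vertical.
  have iC : mu.-integrable `[(- T), T] (EFin \o (fun=> C / (1 + T ^+ 2))).
    apply: continuous_compact_integrable; first exact: segment_compact.
    by apply: continuous_subspaceT; exact: cst_continuous.
  apply: le_trans (le_normr_Rintegral mI iF) _.
  apply: (@le_trans _ _ (\int[mu]_(y in `[(- T), T]) (C / (1 + T ^+ 2)))%R).
    apply: le_Rintegral => //.
      have := integrable_norm iF; exact.
    move=> y _; apply: le_trans (normr_Re_le _) _; apply: le_trans (FC _ T0) _.
    by rewrite ler_wpM2l// lef_pV2 ?posrE; nra.
  rewrite Rintegral_cst//.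
  rewrite (_ : fine _ = T + T); last first.
    have -> : T + T = fine (T + T)%:E by [].
    congr fine; have := @lebesgue_measure_itv R `[(- T), T]%R.
    by rewrite /= lte_fin ifT ?opprK//; lra.
  rewrite /= le_eqVlt; apply/orP; left; apply/eqP; ring.
have SrT : `|S T - S r| <= 2 * C / (1 + T ^+ 2) * T.
  (* The derivative is given the dummy value [0] for [s <= 0], so that [choice] returns a total
     function for the mean value theorem. *)
  have dd s : exists d, 0 < s -> is_derive s (1:R) S d /\ `|d| <= 2 * C / (1 + T ^+ 2).
    have [s0|s0] := ltP 0 s; last by exists 0.
    by have [d [? ?]] := integral_vertical_derive T0 s0; exists d.
  have [dS dSP] := choice dd.
  have [|||c] := @MVT_segment _ S dS r T.
  - exact: rT.
  - by move=> s; rewrite in_itv/= => /andP[rs _]; have [] := dSP s; [lra|].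
  - apply: derivable_within_continuous => s; rewrite in_itv/= => /andP[rs _].
    by have [|sd _] := dSP s; [lra|exact: ex_derive].
  rewrite in_itv/= => /andP[rc _] ->; rewrite normrM.
  have [|_ dc] := dSP c; first lra.
  by rewrite ler_pM// ger0_norm; lra.
have -> : 4 * C * T / (1 + T ^+ 2) =
    2 * C * T / (1 + T ^+ 2) + 2 * C / (1 + T ^+ 2) * T by ring.
have -> : (\int[mu]_(y in `[(- T), T]) Re (F (r +i* y)))%R = S T - (S T - S r).
  by rewrite opprB addrCA subrr addr0.
by apply: le_trans (ler_normB _ _) _; exact: lerD.
Qed.

End ContourShift.

(** * Passage to the imaginary axis by dominated convergence *)

Section BoundaryIntegral.
Variable R : realType.
Let mu := @lebesgue_measure R.
Implicit Types (r s x y T : R).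

Lemma integral_oneDsqr : (\int[mu]_x (oneDsqr x)^-1%:E = (pi : R)%:E)%E.
Proof.
rewrite ge0_symfun_integralT.
- have -> : [set x : R | 0 <= x] = `[0, +oo[%classic.
    by apply/seteqP; split => x /=; rewrite in_itv/= andbT.
  rewrite integral0y_oneDsqr -EFinM; congr (_%:E); by field.
- by move=> x; rewrite invr_ge0 (le_trans ler01 (oneDsqr_ge1 x)).
- exact: continuous_oneDsqrV.
- by move=> x /=; rewrite /oneDsqr sqrrN.
Qed.

Lemma integrable_oneDsqr : mu.-integrable setT (EFin \o (fun x => (oneDsqr x)^-1)).
Proof.
apply/integrableP; split.
  apply/measurable_EFinP; apply: continuous_measurable_fun.
  exact: continuous_oneDsqrV.
under eq_integral => x _.
  rewrite /= ger0_norm ?invr_ge0 ?(le_trans ler01 (oneDsqr_ge1 x))//; over.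
by rewrite /= integral_oneDsqr ltry.
Qed.

Variables (F : R[i] -> R[i]) (C : R) (f : R -> R).
Hypothesis holF : forall r, 0 < r -> holo_bdd_deriv r F.
Hypothesis FC : forall x y, 0 < x -> normc (F (x +i* y)) <= C / (1 + x ^+ 2 + y ^+ 2).
Hypothesis mf : measurable_fun setT f.
Hypothesis Ff : {ae mu, forall y, Re (F (n.+1%:R^-1 +i* y)) @[n --> \oo] --> f y}.

(** One index drives both limits: [f_ n] is [Re F] at abscissa [n.+1%:R^-1], cut off to
    [[- n.+1, n.+1]]. It is dominated by [C / (1 + y ^+ 2)], and [integral_vertical_bound] makes its
    integral at most [4 * C / n.+1]. Convergence almost everywhere suffices, which allows for
    singular points on the axis. *)
Lemma boundary_integral0 :
  mu.-integrable setT (EFin \o f) /\ (\int[mu]_y (f y)%:E = 0)%E.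
Proof.
pose D n : set R := `[(- n.+1%:R), n.+1%:R].
pose f_ n : R -> R := (fun y => Re (F (n.+1%:R^-1 +i* y))) \_ (D n).
have x0 n : 0 < n.+1%:R^-1 :> R by rewrite invr_gt0.
have C0 : 0 <= C.
  have := le_trans (normc_ge0 _) (FC 0 (x0 0%N)).
  by rewrite pmulr_lge0// invr_gt0; have := x0 0%N; nra.
have mD n : measurable (D n : set (measurableTypeR R)) by exact: measurable_itv.
have mf_ n : measurable_fun setT (EFin \o f_ n).
  apply/measurable_EFinP; apply/(measurable_restrictT _ (mD n)).
  apply: measurable_funTS; apply: continuous_measurable_fun.
  by apply: cont_vertical (x0 n); exact: holF.
have cvgf : {ae mu, forall y, setT y -> (EFin \o f_ n) y @[n --> \oo] --> (EFin \o f) y}.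
  apply: (@filterS _ _ (ae_filter_ringOfSetsType _) _ _ _ Ff) => y Fy _.
  apply: cvg_EFin; first exact: nearW.
  apply: cvg_trans Fy; apply: near_eq_cvg; near=> n.
  rewrite /f_ /= patchE mem_set// /D/= in_itv/=.
  have : `|y| <= n.+1%:R.
    rewrite (@le_trans _ _ (n%:R))//; last by rewrite ler_nat.
    by near: n; exact: nbhs_infty_ger.
  by rewrite ler_norml.
have ig : mu.-integrable setT (EFin \o (fun y => C * (oneDsqr y)^-1)).
  rewrite [X in integrable _ _ X](_ : _ =
      (fun y => C%:E * (EFin \o (fun y => (oneDsqr y)^-1)%R) y))%E.
    exact: integrableZl integrable_oneDsqr.
  by apply/funext => y; rewrite /= EFinM.
have dom : {ae mu, forall y n, setT y ->
    (`|(EFin \o f_ n) y| <= (EFin \o (fun y => (C * (oneDsqr y)^-1)%R)) y)%E}.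
  apply: aeW => y n _; rewrite /= lee_fin /f_ patchE.
  have oy : 0 < oneDsqr y by exact: lt_le_trans ltr01 (oneDsqr_ge1 y).
  case: ifPn => _; last by rewrite normr0 mulr_ge0// invr_ge0 ltW.
  apply: le_trans (normr_Re_le _) _; apply: le_trans (FC _ (x0 n)) _.
  rewrite ler_wpM2l// lef_pV2 ?posrE//; last first.
    by rewrite -addrA ltr_pwDl// addr_ge0 ?sqr_ge0.
  by rewrite /oneDsqr/= lerD2r lerDl sqr_ge0.
have mfE : measurable_fun setT (EFin \o f) by exact/measurable_EFinP.
have [intf _ cvgint] := @dominated_convergence _ (measurableTypeR R) R
  (@lebesgue_measure R) setT measurableT (fun n => EFin \o f_ n) (EFin \o f)
  _ mf_ mfE cvgf ig dom.
split => //.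
suff c0 : (\int[mu]_y (EFin \o f_ n) y)%E @[n --> \oo] --> (0 : \bar R).
  exact: cvg_unique cvgint c0.
have intfn n : (\int[mu]_y (EFin \o f_ n) y)%E =
    (\int[mu]_(y in D n) Re (F (n.+1%:R^-1 +i* y)))%R%:E.
  rewrite /Rintegral fineK.
    rewrite [RHS]integral_mkcond; apply: eq_integral => y _.
    by rewrite /f_ /= !patchE; case: ifP.
  apply: integrable_fin_num => //.
  apply: continuous_compact_integrable; first exact: segment_compact.
  by apply: continuous_subspaceT; apply: cont_vertical (x0 n); exact: holF.
under eq_fun do rewrite intfn.
apply: cvg_EFin; first exact: nearW.
apply: norm_cvg0.
apply: (@squeeze_cvgr _ _ _ _ (cst 0) (fun n => 4 * C * n.+1%:R^-1)).
- apply: nearW => n /=; rewrite normr_ge0/=.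
  have n1 : 1 <= n.+1%:R :> R by rewrite ler1n.
  have n0 : 0 < n.+1%:R :> R by rewrite ltr0n.
  have le1 : n.+1%:R^-1 <= n.+1%:R :> R by rewrite (le_trans _ n1)// invf_le1.
  apply: le_trans (integral_vertical_bound holF FC (x0 n) le1) _.
  rewrite -(mulrA (4 * C)) ler_wpM2l ?mulr_ge0//.
  rewrite ler_pdivrMr; last by nra.
  by rewrite mulrDr mulr1 expr2 mulKf ?gt_eqF// lerDr invr_ge0 ltW.
- exact: cvg_cst.
- rewrite -[X in _ --> X](mulr0 (4 * C)); apply: cvgM; first exact: cvg_cst.
  exact: cvg_harmonic.
Unshelve. all: by end_near. Qed.

End BoundaryIntegral.

(** * The delay integral *)

Section DelayExponential.
Variable R : realType.
Implicit Types (r s t u v x y : R) (z w : R[i]).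

(** The lower end [m] covers both uses: [expR (- s)] is 1-Lipschitz only on [0 <= s], while for
    [cos] and [sin] the smaller of the two points is taken. *)
Lemma lipschitz1_from (m : R) (f df : R -> R) :
  (forall s, m <= s -> is_derive s (1 : R) f (df s)) ->
  (forall s, m <= s -> `|df s| <= 1) ->
  forall u v, m <= u -> m <= v -> `|f u - f v| <= `|u - v|.
Proof.
move=> dfP dfle u v; wlog uv : u v / v <= u.
  move=> W mu mv; have [vu|/ltW uv] := leP v u; first exact: W.
  by rewrite distrC (distrC u); exact: W.
move=> mu mv.
have [||c] := @MVT_segment _ f df v u uv.
- by move=> s; rewrite in_itv/= => /andP[vs _]; apply: dfP; lra.
- apply: derivable_within_continuous => s; rewrite in_itv/= => /andP[vs _].
  by have sd := dfP s (le_trans mv vs); exact: ex_derive.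
rewrite in_itv/= => /andP[vc _] ->.
rewrite normrM -[leRHS]mul1r ler_wpM2r// dfle//; lra.
Qed.

Lemma cos_lipschitz1 u v : `|cos u - cos v| <= `|u - v|.
Proof.
apply: (@lipschitz1_from (Num.min u v) cos (fun s => - sin s)).
- by move=> s _; rewrite normrN ler_norml sin_geN1 sin_le1.
- by rewrite ge_min lexx.
- by rewrite ge_min lexx orbT.
Qed.

Lemma sin_lipschitz1 u v : `|sin u - sin v| <= `|u - v|.
Proof.
apply: (@lipschitz1_from (Num.min u v) sin cos).
- by move=> s _; rewrite ler_norml cos_geN1 cos_le1.
- by rewrite ge_min lexx.
- by rewrite ge_min lexx orbT.
Qed.

Lemma expRN_lipschitz1 u v : 0 <= u -> 0 <= v ->
  `|expR (- u) - expR (- v)| <= `|u - v|.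
Proof.
apply: (@lipschitz1_from 0 (fun s => expR (- s)) (fun s => expR (- s) * (- 1))).
move=> s s0; rewrite normrM normrN1 mulr1 ger0_norm ?expR_ge0//.
  by rewrite -expR0 ler_expR; lra.
Qed.

(** The complex exponential of [- a z], in real and imaginary parts. *)
Definition cexpm (a : R) (z : R[i]) : R[i] :=
  (expR (- (a * Re z)) * cos (a * Im z))
  +i* (- (expR (- (a * Re z)) * sin (a * Im z))).

Lemma normc_cexpm a z : normc (cexpm a z) = expR (- (a * Re z)).
Proof.
rewrite normcE2 /= sqrrN !exprMn -mulrDr cos2Dsin2 mulr1 sqrtr_sqr.
by rewrite ger0_norm// expR_ge0.
Qed.

Lemma normc_cexpm_le1 a z : 0 <= a -> 0 <= Re z -> normc (cexpm a z) <= 1.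
Proof. by move=> a0 z0; rewrite normc_cexpm -expR0 ler_expR; nra. Qed.

(** The constant [4 * a] counts two components, each a product of two factors that vary by at most
    [a * normc (z - w)] and are bounded by 1. [key] treats [cos] and [sin] together. *)
Lemma cexpm_lipschitz a z w : 0 <= a -> 0 <= Re z -> 0 <= Re w ->
  normc (cexpm a z - cexpm a w) <= 4 * a * normc (z - w).
Proof.
case: z w => [x y] [x' y'] a0 z0 w0.
have x0 : 0 <= x by []; have x'0 : 0 <= x' by [].
have key (f : R -> R) : (forall u, `|f u| <= 1) ->
    (forall u v, `|f u - f v| <= `|u - v|) ->
    `|expR (- (a * x)) * f (a * y) - expR (- (a * x')) * f (a * y')|
     <= 2 * a * normc (x +i* y - x' +i* y').
  move=> f1 fl.
  have -> : expR (- (a * x)) * f (a * y) - expR (- (a * x')) * f (a * y') =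
   (expR (- (a * x)) - expR (- (a * x'))) * f (a * y)
   + expR (- (a * x')) * (f (a * y) - f (a * y')) by ring.
  have E : `|expR (- (a * x)) - expR (- (a * x'))| <= a * normc (x +i* y - x' +i* y').
    apply: le_trans (expRN_lipschitz1 _ _) _; rewrite ?mulr_ge0//.
    rewrite -mulrBr normrM (ger0_norm a0) ler_wpM2l//.
    exact: (normr_Re_le (x +i* y - x' +i* y')).
  have G : `|f (a * y) - f (a * y')| <= a * normc (x +i* y - x' +i* y').
    apply: le_trans (fl _ _) _.
    rewrite -mulrBr normrM (ger0_norm a0) ler_wpM2l//.
    exact: (normr_Im_le (x +i* y - x' +i* y')).
  have e1 : `|expR (- (a * x'))| <= 1.
    by rewrite ger0_norm ?expR_ge0// -expR0 ler_expR; nra.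
  apply: le_trans (ler_normD _ _) _; rewrite !normrM.
  have H1 := ler_pM (normr_ge0 _) (normr_ge0 _) E (f1 (a * y)).
  have H2 := ler_pM (normr_ge0 _) (normr_ge0 _) e1 G.
  lra.
apply: le_trans (normc_le_ReIm _) _.
have -> : 4 * a * normc (x +i* y - x' +i* y') =
  2 * a * normc (x +i* y - x' +i* y') + 2 * a * normc (x +i* y - x' +i* y') by ring.
apply: lerD.
- by apply: (key cos) cos_lipschitz1 => u; rewrite ler_norml cos_geN1 cos_le1.
- have -> : Im (cexpm a (x +i* y) - cexpm a (x' +i* y')) =
   - (expR (- (a * x)) * sin (a * y) - expR (- (a * x')) * sin (a * y')) by rewrite /=; ring.
  by rewrite normrN; apply: (key sin) sin_lipschitz1 => u; rewrite ler_norml sin_geN1 sin_le1.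
Qed.

Lemma is_derive_scale (a t : R) : is_derive t (1 : R) (fun s => a * s) a.
Proof.
have -> : (fun s => a * s) = a *: (@id R) by [].
by apply: is_derive_eq; rewrite /GRing.scale/= mulr1.
Qed.

Lemma holo_cexpm a r : 0 <= a -> 0 <= r -> holo_bdd_deriv r (cexpm a).
Proof.
move=> a0 r0; exists (fun z => (- a)%:C * cexpm a z), a => x y rx.
have dE : is_derive x (1 : R) (fun s => expR (- (a * s))) (expR (- (a * x)) * (- a)).
  have dN : is_derive x (1 : R) (fun s => - (a * s)) (- a).
    by have d := is_derive_scale a x; exact: is_deriveN.
  exact: (@is_derive1_comp _ expR _ x _ _ (is_derive_expR _) dN).
have dC : is_derive y (1 : R) (fun s => cos (a * s)) (- sin (a * y) * a).
  exact: (@is_derive1_comp _ cos _ y _ _ (is_derive_cos _) (is_derive_scale a y)).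
have dS : is_derive y (1 : R) (fun s => sin (a * s)) (cos (a * y) * a).
  exact: (@is_derive1_comp _ sin _ y _ _ (is_derive_sin _) (is_derive_scale a y)).
have cy : cderive (fun s => cexpm a (x +i* s)) y ('i * ((- a)%:C * cexpm a (x +i* y))).
  split => /=.
  - rewrite (_ : (fun s => _) = expR (- (a * x)) *: (fun s => cos (a * s))); last by [].
    by apply: is_derive_eq; rewrite /GRing.scale/=; ring.
  - rewrite (_ : (fun s => _) = - (expR (- (a * x)) *: (fun s => sin (a * s)))); last by [].
    by apply: is_derive_eq; rewrite /GRing.scale/=; ring.
split => //.
- split => /=.
  + rewrite (_ : (fun s => _) = cos (a * y) *: (fun s => expR (- (a * s)))); last first.
      by apply/funext => s; rewrite /= mulrC.
    by apply: is_derive_eq; rewrite /GRing.scale/=; ring.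
  + rewrite (_ : (fun s => _) = - (sin (a * y) *: (fun s => expR (- (a * s))))); last first.
      by apply/funext => s; rewrite /= mulrC.
    by apply: is_derive_eq; rewrite /GRing.scale/=; ring.
- by apply: ccontM (ccont_cst _ _) (cderive_ccont cy).
- rewrite Normc.normcM -[leRHS]mulr1 ler_pM ?normc_ge0//; last first.
    by apply: normc_cexpm_le1 => //=; lra.
  by rewrite normcE2/= expr0n addr0 sqrtr_sqr normrN ger0_norm.
Qed.

(* With [|y| <= y0] for a fixed [y0 > 1] such that [a * y0 < pi / 2], the real
   part is bounded below; otherwise [|z| >= y0 > 1 >= |cexpm a z|]. *)
Lemma char_fun_lower_bound a : 0 <= a -> a < pi / 2 ->
  exists2 e : R, 0 < e & forall x y, 0 <= x -> e <= normc (x +i* y + cexpm a (x +i* y)).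
Proof.
move=> a0 api.
have pi0 := @pi_gt0 R.
(* Chosen so that [a * (1 + b) = pi / 2 - b], which is below [pi / 2]; the threshold for [|y|] is
   [1 + b]. *)
pose b := (pi / 2 - a) / (1 + a).
have b0 : 0 < b by rewrite /b divr_gt0//; lra.
have aby : a * (1 + b) < pi / 2.
  have : b * (1 + a) = pi / 2 - a by rewrite /b divfK// gt_eqF//; lra.
  nra.
pose k := cos (a * (1 + b)).
have k0 : 0 < k by apply: cos_gt0_pihalf; rewrite aby andbT; nra.
have d0 : 0 < 1 + a * k by nra.
(* For small [|y|], put [E = expR (- (a * x))], so [E >= 1 - a * x] and [cos (a * y) >= k]. Then
   [(x + E * cos (a * y)) * (1 + a * k)] is at least [x + a * k * x + k * (1 - a * x) = x + k]. For
   large [|y|], the bound is [b = (1 + b) - 1]. *)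
exists (Num.min (k / (1 + a * k)) b).
  by rewrite lt_min b0 divr_gt0.
move=> x y x0; have [yb|yb] := leP `|y| (1 + b).
- rewrite ge_min; apply/orP; left.
  apply: le_trans (le_trans (ler_norm _) (normr_Re_le _)).
  rewrite /= ler_pdivrMr//.
  have ck : k <= cos (a * y).
    have -> : cos (a * y) = cos (a * `|y|).
      by rewrite -(cos_norm (a * y)) normrM (ger0_norm a0).
    have y0 := normr_ge0 y.
    have ay1 : a * `|y| <= a * (1 + b) by rewrite ler_wpM2l.
    have ay0 : 0 <= a * `|y| by rewrite mulr_ge0.
    rewrite /k leNgt ltr_cos ?in_itv/= ?ay0 ?andTb; first by rewrite -leNgt.
      by apply/andP; split; lra.
    by lra.
  have ex : 1 - a * x <= expR (- (a * x)) by exact: expR_ge1Dx.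
  have ep := expR_ge0 (- (a * x)).
  have kx : 0 <= (cos (a * y) - k) * expR (- (a * x)) by rewrite mulr_ge0//; lra.
  have kk : 0 <= k * (expR (- (a * x)) - (1 - a * x)) by rewrite mulr_ge0//; lra.
  have akx : 0 <= a * k * (expR (- (a * x)) * cos (a * y)).
    by rewrite !mulr_ge0//; lra.
  nra.
- rewrite ge_min; apply/orP; right.
  have := normc_tri_sub (x +i* y) (- cexpm a (x +i* y)); rewrite opprK.
  apply: le_trans; rewrite normc_opp.
  have Hy : `|y| <= normc (x +i* y) := normr_Im_le (x +i* y).
  have := @normc_cexpm_le1 a (x +i* y) a0 x0; lra.
Qed.

End DelayExponential.

Lemma negligible_set1 (R : realType) (y : R) :
  (@lebesgue_measure R).-negligible [set y].
Proof. by apply/negligibleP; [exact: measurable_set1|exact: lebesgue_measure_set1]. Qed.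

(** * The normalized integral, with unit eigenvalue and delay [a] *)

Section DelayIntegral.
Variable R : realType.
Let mu := @lebesgue_measure R.
Implicit Types (r s x y : R) (z w : R[i]).
Variable a : R.
Hypotheses (a0 : 0 <= a) (api : a < pi / 2).

Let c : R := cos a / (1 - sin a).

Let q z := cexpm a z.
Let p z := z + q z.

(* Equals [(q - z) / (q + z) + c * (z - 1) / (z + 1)]; on the imaginary axis the
   real part of the first term is [(1 - y^2) / |p|^2], and the second one cancels
   its values at the zeros [+i, -i] of [1 + z^2]. *)
Let H z : R[i] :=
  2%:C * (q z * (p z)^-1) + ((c - 1)%:C + (- (2 * c))%:C * (z + 1)^-1).

(** The factor [1 + z^2] is kept split, because at most one of [z - i] and [z + i] is small at a
    given point. *)
Let g z : R[i] := H z * ((z + 0 -i* 1)^-1 * (z + 0 +i* 1)^-1).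

Lemma sin_lt1_pihalf : sin a < 1.
Proof.
have pi0 := @pi_gt0 R; move: (a0) (api) => a0' api'.
have c0 : 0 < cos a by apply: cos_gt0_pihalf; apply/andP; split; lra.
have := cos2Dsin2 a; nra.
Qed.

Let s1 := sin_lt1_pihalf.

(** Both signs [e = 1] and [e = -1] are handled at once. From [c * (1 - sin a) = cos a] and
    [c * cos a = 1 + sin a] one gets [q / p = (1 - i e c) / 2], and [1 / (z + 1) = (1 - i e) / 2];
    the terms of [H] then cancel. *)
Let H_pole (e : R) : e ^+ 2 = 1 -> cos (a * e) = cos a -> sin (a * e) = e * sin a ->
  H (0 +i* e) = 0.
Proof.
move=> e2 ce se.
have s0 : 1 - sin a != 0 by rewrite subr_eq0 gt_eqF.
have cs := cos2Dsin2 a.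
have qE : q (0 +i* e) = cos a +i* (- (e * sin a)).
  by rewrite /q /cexpm /= mulr0 oppr0 expR0 !mul1r ce se.
have pE : p (0 +i* e) = cos a +i* (e * (1 - sin a)).
  by rewrite /p qE; apply/eqP; rewrite eq_complex/=; apply/andP; split; apply/eqP; ring.
have e0 : e != 0 by rewrite -sqrf_eq0 e2 oner_eq0.
have p0 : p (0 +i* e) != 0.
  by rewrite pE eq_complex/= negb_and mulf_eq0 (negPf e0) (negPf s0) orbT.
have c1 : c * (1 - sin a) = cos a by rewrite /c divfK.
have cc : c * cos a = 1 + sin a.
  apply: (mulIf s0); rewrite mulrAC c1; lra.
have qp : q (0 +i* e) * (p (0 +i* e))^-1 = 2^-1 +i* (- (e * c / 2)).
  apply: (mulIf p0); rewrite mulfVK// pE qE.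
  apply/eqP; rewrite eq_complex/=; apply/andP; split; apply/eqP.
  - have -> : 2^-1 * cos a - - (e * c / 2) * (e * (1 - sin a)) =
      2^-1 * cos a + e ^+ 2 * (c * (1 - sin a)) / 2 by ring.
    by rewrite e2 c1; field.
  - have -> : 2^-1 * (e * (1 - sin a)) + - (e * c / 2) * cos a =
      e * (1 - sin a - c * cos a) / 2 by ring.
    by rewrite cc; field.
have iV : (0 +i* e + 1)^-1 = 2^-1 +i* (- (e / 2)) :> R[i].
  have n0 : 0 +i* e + 1 != 0 :> R[i] by rewrite eq_complex/= add0r oner_eq0.
  apply: (mulIf n0); rewrite mulVf//.
  apply/eqP; rewrite eq_complex/=; apply/andP; split; apply/eqP; last by field.
  have -> : 2^-1 * (0 + 1) - - (e / 2) * (e + 0) = 2^-1 + e ^+ 2 / 2 by ring.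
  by rewrite e2; field.
rewrite /H qp iV.
by apply/eqP; rewrite eq_complex/=; apply/andP; split; apply/eqP; field.
Qed.

Let Hi : H (0 +i* 1) = 0.
Proof. by apply: H_pole; rewrite ?expr1n ?mulr1 ?mul1r. Qed.

Let HNi : H (0 +i* (- 1)) = 0.
Proof. by apply: H_pole; rewrite ?sqrrN ?expr1n// mulrN1 ?cosN// sinN mulN1r. Qed.

Let normc_real (k : R) : normc k%:C = `|k|.
Proof. by rewrite normcE2/= expr0n addr0 sqrtr_sqr. Qed.

Let normc_addr1 z : 0 <= Re z -> 1 <= normc (z + 1).
Proof.
move=> z0; apply: le_trans (le_trans (ler_norm _) (normr_Re_le _)).
by case: z z0 => x y /= x0; lra.
Qed.

Let H_bdd : exists2 B : R, 0 <= B & forall z, 0 <= Re z -> normc (H z) <= B.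
Proof.
have [e e0 eP] := char_fun_lower_bound a0 api.
exists (2 * e^-1 + (`|c - 1| + 2 * `|c|)).
  by rewrite !addr_ge0 ?mulr_ge0// invr_ge0 ltW.
move=> z z0; rewrite /H; apply: le_trans (normc_triangle _ _) _.
have ez : e <= normc (p z) by case: (z) z0 => x y /= ?; exact: eP.
have pz0 := lt_le_trans e0 ez.
apply: lerD.
- rewrite !Normc.normcM Normc.normcV normc_real ger0_norm//.
  rewrite ler_wpM2l// -[leRHS]mul1r ler_pM ?normc_ge0 ?invr_ge0 ?normc_ge0//.
    exact: normc_cexpm_le1.
  by rewrite lef_pV2.
- apply: le_trans (normc_triangle _ _) _.
  rewrite Normc.normcM Normc.normcV !normc_real lerD2l normrN normrM ger0_norm//.
  by rewrite -[leRHS]mulr1 ler_wpM2l ?mulr_ge0// invf_le1 ?normc_addr1//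
     (lt_le_trans ltr01) ?normc_addr1.
Qed.

(** Used with [w] a zero of [1 + z^2], to bound [H z] by a multiple of the distance to that point.
    In [E1] the difference [q z - q w] is multiplied by [w] alone, so [normc w = 1] keeps the
    constant uniform in [z]. *)
Let H_lip : exists2 B : R, 0 <= B & forall z w, 0 <= Re z -> 0 <= Re w ->
  normc w = 1 -> normc (H z - H w) <= B * normc (z - w).
Proof.
have [e e0 eP] := char_fun_lower_bound a0 api.
have ez z : 0 <= Re z -> e <= normc (p z) by case: z => x y ?; exact: eP.
exists (2 * (4 * a + 1) / e / e + 2 * `|c|).
  by rewrite !addr_ge0 ?mulr_ge0// ?addr_ge0 ?mulr_ge0// invr_ge0 ltW.
move=> z w z0 w0 w1.
have pz := lt_le_trans e0 (ez z z0); have pw := lt_le_trans e0 (ez w w0).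
have pz0 : p z != 0 by rewrite -normc_gt0.
have pw0 : p w != 0 by rewrite -normc_gt0.
have nz := normc_addr1 z0; have nw := normc_addr1 w0.
have z10 : z + 1 != 0 by rewrite -normc_gt0 (lt_le_trans ltr01).
have w10 : w + 1 != 0 by rewrite -normc_gt0 (lt_le_trans ltr01).
have E1 : q z * (p z)^-1 - q w * (p w)^-1 =
   ((q z - q w) * w + q w * (w - z)) * ((p z)^-1 * (p w)^-1).
  by move: pz0 pw0; rewrite /p => ? ?; field; apply/andP.
have E2 : (z + 1)^-1 - (w + 1)^-1 = (w - z) * ((z + 1)^-1 * (w + 1)^-1).
  by field; apply/andP.
have -> : H z - H w = 2%:C * (q z * (p z)^-1 - q w * (p w)^-1)
   + (- (2 * c))%:C * ((z + 1)^-1 - (w + 1)^-1) by rewrite /H; ring.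
apply: le_trans (normc_triangle _ _) _; rewrite [leRHS]mulrDl.
have nzw := normc_ge0 (z - w).
apply: lerD; rewrite Normc.normcM normc_real.
- rewrite ger0_norm// E1 Normc.normcM.
  have A : normc ((q z - q w) * w + q w * (w - z)) <= (4 * a + 1) * normc (z - w).
    apply: le_trans (normc_triangle _ _) _; rewrite !Normc.normcM w1 mulr1 [leRHS]mulrDl.
    apply: lerD; first exact: cexpm_lipschitz.
    by rewrite normc_subr ler_wpM2r// normc_cexpm_le1.
  have Bd : normc ((p z)^-1 * (p w)^-1) <= e^-1 * e^-1.
    by rewrite Normc.normcM !Normc.normcV ler_pM ?invr_ge0 ?normc_ge0// lef_pV2 ?posrE// ez.
  have -> : 2 * (4 * a + 1) / e / e * normc (z - w) =
     2 * (((4 * a + 1) * normc (z - w)) * (e^-1 * e^-1)) by ring.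
  by rewrite ler_wpM2l// ler_pM ?normc_ge0.
- rewrite normrN normrM (@ger0_norm _ 2)// ler_wpM2l ?mulr_ge0//.
  rewrite E2 !Normc.normcM !Normc.normcV normc_subr -[leRHS]mulr1 ler_wpM2l//.
  by rewrite -[leRHS]mulr1 ler_pM ?invr_ge0 ?normc_ge0// invf_le1// (lt_le_trans ltr01).
Qed.

(** With [m = 1 + |z|], the factor at the pole in the same half (upper or lower) as [z] is paired
    with [H] and gives [O(1 / m)]; the other pole is far and gives another [O(1 / m)]. Finally
    [m ^+ 2] dominates [1 + x ^+ 2 + y ^+ 2]. *)
Let g_bound : exists C : R, forall x y, 0 < x ->
  normc (g (x +i* y)) <= C / (1 + x ^+ 2 + y ^+ 2).
Proof.
have [B B0 HB] := H_bdd; have [K K0 HK] := H_lip.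
exists (2 * (3 * B + 3 * K)) => x y x0.
set z := x +i* y; have z0 : 0 <= Re z by exact: ltW.
pose m := 1 + normc z.
have zz : normc z ^+ 2 = x ^+ 2 + y ^+ 2 := normc_sqr z.
have mge : 1 + x ^+ 2 + y ^+ 2 <= m ^+ 2.
  by rewrite /m; have := normc_ge0 z; nra.
have m0 : 0 < m by rewrite /m; have := normc_ge0 z; lra.
have nI (e : R) : e ^+ 2 = 1 -> normc (0 +i* e) = 1.
  by move=> e1; rewrite normcE2/= expr0n/= add0r e1 sqrtr1.
have near_pole (e : R) : e ^+ 2 = 1 -> H (0 +i* e) = 0 ->
    normc (H z) / normc (z - 0 +i* e) <= (3 * B + 3 * K) / m.
  move=> e1 He.
  have d0 : 0 < normc (z - 0 +i* e).
    apply: lt_le_trans (normr_Re_le _); rewrite /z /= subr0 normr_gt0; lra.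
  have L := HK z (0 +i* e) z0 (lexx _) (nI e e1); rewrite He subr0 in L.
  have U := HB z z0.
  have tri : m <= 2 + normc (z - 0 +i* e).
    have := normc_tri_sub z (0 +i* e); rewrite (nI e e1) /m; lra.
  rewrite ler_pdivrMr// mulrAC ler_pdivlMr//.
  have hz := normc_ge0 (H z).
  (* At distance at least 1, [m] is at most 3 times the distance and [|H| <= B]; closer, [m <= 3]
     and the Lipschitz bound [K] takes over. The sum [3 * B + 3 * K] covers both cases. *)
  have [d1|d1] := leP 1 (normc (z - 0 +i* e)); first by nra.
  by nra.
have far_pole (e : R) : e ^+ 2 = 1 -> 0 <= e * y -> (normc (z + 0 +i* e))^-1 <= 2 / m.
  move=> e1 ey.
  (* The cross term [2 * e * y] is nonnegative, so this modulus is at least both 1 and [normc z],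
     hence at least [m / 2]. *)
  have nn : (1 + x ^+ 2 + y ^+ 2) <= normc (z + 0 +i* e) ^+ 2.
    by rewrite normc_sqr /z/= addr0; nra.
  have n0 := normc_ge0 (z + 0 +i* e).
  have n1 : 1 <= normc (z + 0 +i* e) by have := sqr_ge0 x; have := sqr_ge0 y; nra.
  have n2 : normc z <= normc (z + 0 +i* e).
    by rewrite -(@ler_pXn2r _ 2)// ?nnegrE ?normc_ge0// zz; lra.
  by rewrite -invf_div lef_pV2 ?posrE ?divr_gt0//; rewrite /m; lra.
have conv : 2 / m * ((3 * B + 3 * K) / m) <= 2 * (3 * B + 3 * K) / (1 + x ^+ 2 + y ^+ 2).
  have -> : 2 / m * ((3 * B + 3 * K) / m) = 2 * (3 * B + 3 * K) / m ^+ 2.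
    by field; rewrite gt_eqF.
  have q0 : 0 < 1 + x ^+ 2 + y ^+ 2 by nra.
  by rewrite ler_wpM2l ?mulr_ge0 ?addr_ge0 ?mulr_ge0// lef_pV2 ?posrE// (lt_le_trans q0).
apply: le_trans conv.
have zm : z + 0 -i* 1 = z - 0 +i* 1.
  by rewrite /z; apply/eqP; rewrite eq_complex/= oppr0 !eqxx.
have zp : z + 0 +i* 1 = z - 0 +i* (-1).
  by rewrite /z; apply/eqP; rewrite eq_complex/= oppr0 opprK !eqxx.
rewrite /g !Normc.normcM !Normc.normcV mulrCA.
have [y0|y0] := leP 0 y.
- rewrite mulrA mulrC; apply: ler_pM; rewrite ?mulr_ge0 ?invr_ge0 ?normc_ge0//.
    by apply: far_pole; rewrite ?expr1n ?mul1r.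
  by rewrite zm mulrC; apply: near_pole; rewrite ?expr1n.
- apply: ler_pM; rewrite ?mulr_ge0 ?invr_ge0 ?normc_ge0//.
    apply: far_pole; rewrite ?sqrrN ?expr1n//; lra.
  by rewrite zp; apply: near_pole; rewrite ?sqrrN ?expr1n.
Qed.

Let holo_add r (k : R[i]) : holo_bdd_deriv r (fun z => z + k).
Proof. exact: holo_bdd_derivD (holo_bdd_deriv_id _) (holo_bdd_deriv_cst _ _). Qed.

(** On [r < Re z] every denominator is bounded below: [p] by [e], [z + 1] by 1, and [z - i], [z + i]
    by [r]. The resulting derivative bound depends on [r], as [holo_bdd_deriv] permits. *)
Let holo_g r : 0 < r -> holo_bdd_deriv r g.
Proof.
move=> r0; have [e e0 eP] := char_fun_lower_bound a0 api.
have ep x y : r < x -> e <= normc (p (x +i* y)) by move=> rx; apply: eP; lra.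
have hq : holo_bdd_deriv r q by apply: holo_cexpm => //; exact: ltW.
have bq : bdd_on_half_plane r q.
  by exists 1 => x y rx; apply: normc_cexpm_le1 => //=; lra.
have hp : holo_bdd_deriv r p by exact: holo_bdd_derivD (holo_bdd_deriv_id _) hq.
have n1 x y : r < x -> 1 <= normc (x +i* y + 1).
  by move=> rx; apply: normc_addr1 => /=; lra.
have nr (k x y : R) : r < x -> r <= normc (x +i* y + 0 +i* k).
  move=> rx; apply: le_trans (le_trans (ler_norm _) (normr_Re_le _)).
  by rewrite /=; lra.
apply: holo_bdd_derivM.
- apply: holo_bdd_derivD.
    apply: holo_bdd_derivM (holo_bdd_deriv_cst _ _) (bdd_on_half_plane_cst _ _) _ _.
      apply: holo_bdd_derivM hq bq (holo_bdd_derivV e0 ep hp) (bdd_on_half_planeV e0 ep).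
    exact: bdd_on_half_planeM bq (bdd_on_half_planeV e0 ep).
  apply: holo_bdd_derivD; first exact: holo_bdd_deriv_cst.
  apply: holo_bdd_derivM (holo_bdd_deriv_cst _ _) (bdd_on_half_plane_cst _ _) _ _.
    exact: holo_bdd_derivV ltr01 n1 (holo_add r 1).
  exact: bdd_on_half_planeV ltr01 n1.
- have [B _ HB] := H_bdd; exists B => x y rx; apply: HB => /=; lra.
- apply: holo_bdd_derivM.
  + exact: holo_bdd_derivV r0 (nr (- 1)) (holo_add r (0 -i* 1)).
  + exact: bdd_on_half_planeV r0 (nr (- 1)).
  + exact: holo_bdd_derivV r0 (nr 1) (holo_add r (0 +i* 1)).
  + exact: bdd_on_half_planeV r0 (nr 1).
- apply: bdd_on_half_planeM.
  + exact: bdd_on_half_planeV r0 (nr (- 1)).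
  + exact: bdd_on_half_planeV r0 (nr 1).
Qed.

(** This is the squared modulus of [p] at [i u]. *)
Definition delay_quad (u : R) : R := 1 + u ^+ 2 - 2 * u * sin (a * u).

Lemma delay_quad_gt0 u : 0 < delay_quad u.
Proof.
have [e e0 /(_ 0 u (lexx _)) eP] := char_fun_lower_bound a0 api.
have -> : delay_quad u = normc (0 +i* u + cexpm a (0 +i* u)) ^+ 2.
  rewrite normc_sqr /= mulr0 oppr0 expR0 !mul1r.
  have := cos2Dsin2 (a * u); rewrite /delay_quad => cs; nra.
by rewrite exprn_gt0// (lt_le_trans e0).
Qed.

(** On the axis [1 + z^2] is the real number [1 - y ^+ 2], so only [Re H] is needed;
    [2 * q / p = (q - z) / p + 1] explains the summand 1 in [E1]. *)
Let g_axis y : y ^+ 2 != 1 ->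
  Re (g (0 +i* y)) = (delay_quad y)^-1 - c * (oneDsqr y)^-1.
Proof.
move=> y1; have D0 := delay_quad_gt0 y.
have o0 : 0 < oneDsqr y by exact: lt_le_trans ltr01 (oneDsqr_ge1 y).
have y2 : 1 - y ^+ 2 != 0 by rewrite subr_eq0 eq_sym.
have cs := cos2Dsin2 (a * y).
have -> : g (0 +i* y) = (1 - y ^+ 2)^-1%:C * H (0 +i* y).
  rewrite /g mulrC; congr (_ * _); rewrite -invfM fmorphV; congr (_^-1).
  by apply/eqP; rewrite eq_complex/=; apply/andP; split; apply/eqP; ring.
have qE : q (0 +i* y) = cos (a * y) +i* (- sin (a * y)).
  by rewrite /q /cexpm /= mulr0 oppr0 expR0 !mul1r.
have pE : p (0 +i* y) = cos (a * y) +i* (y - sin (a * y)).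
  by rewrite /p qE; apply/eqP; rewrite eq_complex/= add0r !eqxx.
have p2 : cos (a * y) ^+ 2 + (y - sin (a * y)) ^+ 2 = delay_quad y.
  by rewrite /delay_quad; nra.
have ReH : Re (H (0 +i* y)) =
    (1 - y ^+ 2) / delay_quad y - c * (1 - y ^+ 2) / oneDsqr y.
  rewrite /H qE pE /= p2.
  have -> : (0 + 1) ^+ 2 + (y + 0) ^+ 2 = oneDsqr y by rewrite /oneDsqr; ring.
  have E1 : 2 * (cos (a * y) * (cos (a * y) / delay_quad y) -
      - sin (a * y) * (- ((y - sin (a * y)) / delay_quad y))) = 
      (1 - y ^+ 2) / delay_quad y + 1.
    have -> : (1 - y ^+ 2) / delay_quad y + 1 = (1 - y ^+ 2 + delay_quad y) / delay_quad y.
      by rewrite [RHS]mulrDl divff// gt_eqF.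
    have -> : 1 - y ^+ 2 + delay_quad y =
        2 * (cos (a * y) ^+ 2 - sin (a * y) * (y - sin (a * y))).
      by rewrite /delay_quad; nra.
    by ring.
  have E2 : c * (1 - y ^+ 2) / oneDsqr y = 2 * c / oneDsqr y - c.
    have -> : 1 - y ^+ 2 = 2 - oneDsqr y by rewrite /oneDsqr; ring.
    by field; rewrite gt_eqF.
  rewrite E2 !mul0r !subr0 E1; ring.
rewrite [LHS](_ : _ = (1 - y ^+ 2)^-1 * Re (H (0 +i* y))); last first.
  by case: (H _) => ? ? /=; rewrite mul0r subr0.
rewrite ReH; field; rewrite y2 !gt_eqF//.
Qed.

Let g_ccont y : y ^+ 2 != 1 -> ccont (fun s => g (s +i* y)) 0.
Proof.
move=> y1.
have [e e0 /(_ 0 y (lexx _)) eP] := char_fun_lower_bound a0 api.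
have cid : ccont (fun s => s +i* y) 0.
  split; first exact: cvg_id.
  exact: cst_continuous.
have cadd k : ccont (fun s => s +i* y + k) 0 by exact: ccontD cid (ccont_cst _ _).
have cq : ccont (fun s => q (s +i* y)) 0.
  have cE : {for 0, continuous (fun s : R => expR (- (a * s)))}.
    apply: continuous_comp; last exact: continuous_expR.
    by apply: continuousN; apply: continuousM; [exact: cst_continuous|exact: cvg_id].
  split => /=.
    by apply: continuousM cE _; exact: cst_continuous.
  by apply: continuousN; apply: continuousM cE _; exact: cst_continuous.
have cp : ccont (fun s => p (s +i* y)) 0 by exact: ccontD.
have cpV : ccont (fun s => (p (s +i* y))^-1) 0.
  by apply: ccontV cp; rewrite -normc_gt0 (lt_le_trans e0).
apply: ccontM.
  apply: ccontD.
    by apply: ccontM; [exact: ccont_cst|exact: ccontM].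
  apply: ccontD; first exact: ccont_cst.
  apply: ccontM; first exact: ccont_cst.
  by apply: ccontV => //; rewrite eq_complex/= add0r oner_eq0.
apply: ccontM; apply: ccontV => //; rewrite eq_complex/= addr0 eqxx/=.
- by rewrite subr_eq0; apply: contra y1 => /eqP->; rewrite expr1n.
- by rewrite addr_eq0; apply: contra y1 => /eqP->; rewrite sqrrN expr1n.
Qed.

Lemma continuous_delay_quad : continuous delay_quad.
Proof.
move=> u; rewrite /delay_quad; apply: cvgB.
  by apply: cvgD; [exact: cvg_cst|exact: exprn_continuous].
apply: cvgM; first by apply: cvgM; [exact: cvg_cst|exact: cvg_id].
apply: (@continuous_comp _ _ _ (fun u => a * u) sin); last exact: continuous_sin.
by apply: cvgM; [exact: cvg_cst|exact: cvg_id].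
Qed.

Lemma continuous_delay_quadV : continuous (fun u => (delay_quad u)^-1).
Proof.
move=> u; apply: continuousV; last exact: continuous_delay_quad.
by rewrite gt_eqF// delay_quad_gt0.
Qed.

Lemma integral_delay_quad :
  mu.-integrable setT (EFin \o (fun u => (delay_quad u)^-1)) /\
  (\int[mu]_u (delay_quad u)^-1%:E = (pi * (cos a / (1 - sin a)))%:E)%E.
Proof.
have [C gC] := g_bound.
pose f u := (delay_quad u)^-1 - c * (oneDsqr u)^-1.
have ioc : mu.-integrable setT (EFin \o (fun y => c * (oneDsqr y)^-1)).
  rewrite [X in integrable _ _ X](_ : _ =
      (fun y => c%:E * (EFin \o (fun y => (oneDsqr y)^-1)%R) y))%E.
    exact: integrableZl (@integrable_oneDsqr R).
  by apply/funext => y; rewrite /= EFinM.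
have [intf intf0] : mu.-integrable setT (EFin \o f) /\ (\int[mu]_y (f y)%:E = 0)%E.
  apply: (boundary_integral0 holo_g gC).
    apply: measurable_funB; first exact: continuous_measurable_fun continuous_delay_quadV.
    by apply: measurable_funM => //; exact: continuous_measurable_fun continuous_oneDsqrV.
  have fin1 : mu.-negligible [set 1; - 1].
    by apply: negligibleU; exact: negligible_set1.
  apply: negligibleS fin1 => y /= ny; apply: contrapT => y1; apply: ny.
  have y2 : y ^+ 2 != 1.
    by rewrite sqrf_eq1 negb_or; apply/andP; split; apply/eqP => yE; apply: y1; [left|right].
  rewrite /f -g_axis//.
  have [cg _] := g_ccont y2.
  apply: (@cvg_comp _ _ _ (fun n => n.+1%:R^-1 : R)
    (fun s => Re (g (s +i* y))) _ (nbhs (0:R))).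
    exact: cvg_harmonic.
  exact: cg.
have fE : (fun u => (delay_quad u)^-1%:E) =
    (fun u => (EFin \o f) u + (EFin \o (fun y => c * (oneDsqr y)^-1)%R) u)%E.
  by apply/funext => u; rewrite /f /= -EFinD subrK.
have iD : mu.-integrable setT (fun u => (delay_quad u)^-1%:E).
  by rewrite fE; exact: integrableD.
split => //.
rewrite fE integralD// intf0 add0e.
under eq_integral do rewrite /= EFinM.
rewrite integralZl//; last exact: integrable_oneDsqr.
by rewrite integral_oneDsqr -EFinM mulrC.
Qed.

End DelayIntegral.

(** * The integrated gain of a single Laplacian mode *)

Section ModeIntegral.
Variable R : realType.
Let mu := @lebesgue_measure R.

(** The squared modulus of [lam / (j w + lam e^(-j tau w))]. For [lam = 0] it vanishes identically,
    also at [w = 0] where division by zero gives 0. *)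
Definition mode_gain (lam tau w : R) : R :=
  lam ^+ 2 / (w ^+ 2 + lam ^+ 2 - 2 * lam * w * sin (tau * w)).

Lemma integral_mode_gain (lam tau : R) : 0 <= lam -> 0 <= tau -> tau * lam < pi / 2 ->
  mu.-integrable setT (EFin \o mode_gain lam tau) /\
  (\int[mu]_w (mode_gain lam tau w)%:E =
   (pi * (lam * (cos (tau * lam) / (1 - sin (tau * lam)))))%:E)%E.
Proof.
rewrite le_eqVlt => /predU1P[<-|lam0] tau0 ltp.
  have -> : mode_gain 0 tau = cst 0.
    by apply/funext => w; rewrite /mode_gain expr0n/= mul0r.
  split; first exact: integrable0.
  by rewrite integral0 mul0r mulr0.
have a0 : 0 <= tau * lam by rewrite mulr_ge0// ltW.
pose a := tau * lam; pose G u : R := (delay_quad a u)^-1.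
have l0 : lam != 0 by rewrite gt_eqF.
have GE w : mode_gain lam tau w = G (lam^-1 * w).
  rewrite /mode_gain /G /delay_quad /a -(mulrA tau) (mulrA lam) mulfV// mul1r.
  apply: (can_inj (@invrK _)); rewrite invf_div invrK.
  by field.
have G0 u : 0 <= G u by rewrite invr_ge0 ltW// delay_quad_gt0.
have cG : continuous G by exact: continuous_delay_quadV.
have [_ intG] := integral_delay_quad a0 ltp.
pose F (x : R) := lam^-1 * x.
have dF (x : R) : is_derive x (1 : R) F lam^-1 by exact: is_derive_scale.
have F'E : derive1 F = cst lam^-1.
  by apply/funext => x; rewrite derive1E derive_val.
have lV0 : 0 < lam^-1 by rewrite invr_gt0.
(* Substitution [u = w / lam] for a nonnegative integrand; integrability of the gain is read off
   afterwards from the finite value. *)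
have sub : (\int[mu]_x (G x)%:E = \int[mu]_x (((G \o F) * derive1 F)%R x)%:E)%E.
  apply: increasing_ge0_integration_by_substitutionT => //.
  - by move=> x y xy; rewrite /F ltr_pM2l.
  - by rewrite F'E; exact: cst_continuous.
  - by rewrite F'E; exact: is_cvg_cst.
  - by rewrite F'E; exact: is_cvg_cst.
  - by apply/gt0_cvgMrNy => //; exact: cvg_id.
  - by apply/gt0_cvgMry => //; exact: cvg_id.
have meG : measurable_fun setT (EFin \o mode_gain lam tau).
  apply/measurable_EFinP; rewrite (_ : mode_gain lam tau = G \o F); last first.
    by apply/funext => w; rewrite GE.
  apply: continuous_measurable_fun => x; apply: continuous_comp; last exact: cG.
  by apply: cvgM; [exact: cvg_cst|exact: cvg_id].
have intE : (\int[mu]_w (mode_gain lam tau w)%:E =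
   (pi * (lam * (cos (tau * lam) / (1 - sin (tau * lam)))))%:E)%E.
  have : (\int[mu]_x (((G \o F) * derive1 F)%R x)%:E =
      lam^-1%:E * \int[mu]_w (mode_gain lam tau w)%:E)%E.
    rewrite -ge0_integralZl_EFin//; last 2 first.
    - by move=> w _; rewrite lee_fin GE.
    - exact: ltW.
    by apply: eq_integral => w _; rewrite F'E /= fctE/= GE /F -EFinM mulrC.
  rewrite -sub intG => E.
  have -> : (\int[mu]_w (mode_gain lam tau w)%:E =
      lam%:E * (lam^-1%:E * \int[mu]_w (mode_gain lam tau w)%:E))%E.
    by rewrite muleA -EFinM mulfV// mul1e.
  rewrite -E -EFinM; congr (_%:E); ring.
split => //; apply/integrableP; split => //.
under eq_integral => w _ do rewrite /= ger0_norm ?GE// -GE.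
by rewrite intE ltry.
Qed.

End ModeIntegral.

(** * Spectral calculus *)

Section SpectralCalculus.
Variables (F : fieldType) (n : nat).
Implicit Types (S X Y : 'M[F]_n) (u v : 'rV[F]_n).

(** The rows of [S] are left eigenvectors. [S] need only be invertible, so symmetry of a matrix of
    this form is argued separately where required. *)
Definition spec_mx S v := invmx S *m diag_mx v *m S.

Lemma spec_mxE S v i j : spec_mx S v i j = \sum_m invmx S i m * v 0 m * S m j.
Proof.
rewrite /spec_mx mxE; apply: eq_bigr => m _; rewrite mul_mx_diag mxE.
by [].
Qed.

Lemma spec_mxM S u v : S \in unitmx ->
  spec_mx S u *m spec_mx S v = spec_mx S (\row_m (u 0 m * v 0 m)).
Proof.
move=> uS; rewrite /spec_mx !mulmxA mulmxK//.
rewrite -(mulmxA _ (diag_mx u)); congr (_ *m _ *m _).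
by apply/matrixP => i j; rewrite mul_diag_mx !mxE mulrnAr.
Qed.

Lemma spec_mx1 S : S \in unitmx -> spec_mx S (const_mx 1) = 1%:M.
Proof. by move=> uS; rewrite /spec_mx diag_const_mx mulmx1 mulVmx. Qed.

Lemma spec_mx_linear S (k : F) u v : spec_mx S (k *: u + v) = k *: spec_mx S u + spec_mx S v.
Proof.
by rewrite /spec_mx linearP/= mulmxDr mulmxDl -scalemxAr -scalemxAl.
Qed.

Lemma spec_mxZ S (k : F) u : spec_mx S (k *: u) = k *: spec_mx S u.
Proof. by rewrite /spec_mx linearZ/= -scalemxAr -scalemxAl. Qed.

Lemma spec_mxB S u v : spec_mx S (u - v) = spec_mx S u - spec_mx S v.
Proof. by rewrite addrC -scaleN1r spec_mx_linear scaleN1r addrC. Qed.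

Lemma spec_mxX S u k : S \in unitmx ->
  spec_mx S u ^+ k = spec_mx S (\row_m (u 0 m ^+ k)).
Proof.
move=> uS; elim: k => [|k IH].
  rewrite expr0 (_ : \row_m _ = const_mx 1) ?spec_mx1//.
  by apply/rowP => m; rewrite !mxE.
rewrite exprS IH -[_ * _]/(_ *m _) spec_mxM//; congr spec_mx.
by apply/rowP => m; rewrite !mxE exprS.
Qed.

Lemma invmx_right X Y : X *m Y = 1%:M -> invmx X = Y.
Proof.
move=> XY; have [uX _] := mulmx1_unit XY.
by rewrite -[RHS](mulKmx uX) XY mulmx1.
Qed.

Lemma invmx_spec S u : S \in unitmx -> (forall m, u 0 m != 0) ->
  invmx (spec_mx S u) = spec_mx S (\row_m (u 0 m)^-1).
Proof.
move=> uS u0; apply: invmx_right; rewrite spec_mxM// -(spec_mx1 uS); congr spec_mx.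
by apply/rowP => m; rewrite !mxE mulfV.
Qed.

End SpectralCalculus.

Lemma map_spec_mx (F K : fieldType) (f : {rmorphism F -> K}) n (S : 'M[F]_n) v :
  map_mx f (spec_mx S v) = spec_mx (map_mx f S) (map_mx f v).
Proof. by rewrite /spec_mx !map_mxM/= map_invmx map_diag_mx. Qed.

(** * Real diagonalization, pseudo-inverses and matrix power series *)

Section RealSpectral.
Variable R : realType.

Lemma cmxE n (X : 'M[R]_n) : cmx X = map_mx (real_complex R) X.
Proof. by []. Qed.

(** The complexified matrix is hermitian, hence diagonalizable with real eigenvalues. Two real
    matrices similar over the complex numbers are similar through a real matrix, which supplies
    [S]. *)
Lemma real_symmetric_spec n (L : 'M[R]_n) : L^T = L ->
  exists (S : 'M[R]_n) (d : 'rV[R]_n), S \in unitmx /\ L = spec_mx S d.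
Proof.
move=> Ls.
have realC (x : R) : (x%:C : R[i]) \is Num.real by apply/complex_realP; exists x.
have Cr : cmx L \is a realmx by apply/mxOverP => i j; rewrite cmxE mxE.
have Csym : cmx L \is symmetricmx.
  apply/is_hermitianmxP; rewrite expr0 scale1r map_mx_id//.
  by rewrite cmxE map_trmx Ls.
have Ch := realsym_hermsym Csym Cr.
have /hermitian_normalmx/orthomx_spectralP E := Ch.
have dr := hermitian_spectral_diag_real Ch.
set P := spectralmx _ in E; set sp := spectral_diag _ in E dr.
have uP : P \in unitmx by exact: spectral_unit.
have Dr : diag_mx sp \is a realmx.
  apply/mxOverP => i j; rewrite mxE; case: (i == j) => /=; last exact: real0.
  by rewrite mulr1n; apply/mxOverP.
have sim : similar_in unitmx (cmx L) (diag_mx sp).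
  exists P => //; apply/similarP => //.
  by rewrite {1}E !mulmxA mulmxV// mul1mx.
have [Q] := real_similar sim Cr Dr.
rewrite inE => /andP[Qr uQ] /(similarP uQ) QE.
pose S : 'M[R]_n := map_mx (@complex.Re R) Q.
pose d : 'rV[R]_n := map_mx (@complex.Re R) sp.
have SQ : map_mx (real_complex R) S = Q.
  by apply/matrixP => i j; rewrite !mxE RRe_real//; apply/mxOverP.
have dsp : map_mx (real_complex R) d = sp.
  by apply/matrixP => i j; rewrite !mxE RRe_real//; apply/mxOverP.
have uS : S \in unitmx by rewrite -(map_unitmx (real_complex R)) SQ.
exists S, d; split => //.
have SL : S *m L = diag_mx d *m S.
  apply: (map_mx_inj (f := real_complex R)).
  by rewrite !map_mxM/= map_diag_mx SQ dsp -QE.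
by rewrite /spec_mx -mulmxA -SL mulKmx.
Qed.

(** Symmetry gives [X Y = (X Z)(X Y) = (X Y X Z)^T = (X Z)^T = X Z], and likewise [Y X = Z X]; then
    [Y = Y X Y = Y X Z = Z X Z = Z]. *)
Lemma MP_inverse_unique n (X Y Z : 'M[R]_n) :
  is_MP_inverse X Y -> is_MP_inverse X Z -> Y = Z.
Proof.
move=> [y1 y2 y3 y4] [z1 z2 z3 z4].
have XYZ : X *m Y = X *m Z.
  rewrite -{1}z1 -!mulmxA mulmxA -z3 -y3 -trmx_mul.
  by rewrite mulmxA y1.
have YXZ : Y *m X = Z *m X.
  rewrite -{1}z1 -(mulmxA X Z) mulmxA -z4 -y4 -trmx_mul.
  by rewrite -mulmxA (mulmxA X) y1.
by rewrite -y2 -mulmxA XYZ mulmxA YXZ z2.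
Qed.

Lemma mp_pinvE n (X Y : 'M[R]_n) : is_MP_inverse X Y -> mp_pinv X = Y.
Proof.
move=> XY; rewrite /mp_pinv; case: xgetP => [Z -> XZ|/(_ Y)//].
exact: MP_inverse_unique XZ XY.
Qed.

(** Each entry of a partial sum is a fixed finite combination of scalar partial sums at the
    eigenvalues, so the limit passes inside. *)
Lemma mx_series_spec n (c : nat -> R) (S : 'M[R]_n) (d : 'rV[R]_n) (f : R -> R) :
  S \in unitmx ->
  (forall x, (\sum_(k < N) c k * x ^+ k) @[N --> \oo] --> f x) ->
  mx_series c (spec_mx S d) = spec_mx S (\row_m f (d 0 m)).
Proof.
move=> uS cf; apply/matrixP => i j; rewrite mxE.
apply/cvg_lim => //.
rewrite spec_mxE.
rewrite (_ : (fun N => _) = (fun N => \sum_m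
    invmx S i m * (\sum_(k < N) c k * d 0 m ^+ k) * S m j)); last first.
  apply/funext => N; rewrite summxE.
  under eq_bigr => k _ do rewrite spec_mxX// mxE spec_mxE big_distrr/=.
  rewrite exchange_big/=; apply: eq_bigr => m _.
  rewrite big_distrr big_distrl/=; apply: eq_bigr => k _; rewrite mxE; ring.
apply: (@cvg_big _ _ +%R); first exact: add_continuous.
move=> m _; apply: cvgM; last exact: cvg_cst.
by apply: cvgM; [exact: cvg_cst|rewrite mxE; exact: cf].
Qed.

Lemma cosmx_spec n (S : 'M[R]_n) (d : 'rV[R]_n) : S \in unitmx ->
  cosmx (spec_mx S d) = spec_mx S (\row_m cos (d 0 m)).
Proof.
move=> uS; apply: mx_series_spec uS _ => x.
have cv : series (cos_coeff x) @ \oo --> cos x.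
  by rewrite unlock; exact: is_cvg_series_cos_coeff.
apply: cvg_trans cv; apply: near_eq_cvg; apply: nearW => N /=.
rewrite /series/= big_mkord; apply: eq_bigr => k _; rewrite /cos_coeff/=.
by case: (odd k) => /=; rewrite ?mul0r// mul1r mulrAC.
Qed.

Lemma sinmx_spec n (S : 'M[R]_n) (d : 'rV[R]_n) : S \in unitmx ->
  sinmx (spec_mx S d) = spec_mx S (\row_m sin (d 0 m)).
Proof.
move=> uS; apply: mx_series_spec uS _ => x.
have cv : series (sin_coeff x) @ \oo --> sin x.
  by rewrite unlock; exact: is_cvg_series_sin_coeff.
apply: cvg_trans cv; apply: near_eq_cvg; apply: nearW => N /=.
rewrite /series/= big_mkord; apply: eq_bigr => k _; rewrite /sin_coeff/=.
case: (boolP (odd k)) => [ko|] /=; rewrite ?mul0r// mul1r mulrAC.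
(* The sign exponents [k.-1./2] of [sin_coeff] and [k./2] of [sinmx] agree for odd [k]. *)
by rewrite -[in k.-1./2](odd_double_half k) ko/= doubleK.
Qed.

End RealSpectral.

(** * Graph Laplacians *)

Section Laplacian.
Variables (R : realType) (n : nat) (A : 'M[R]_n).
Hypothesis gA : undirected_weighted_graph A.
Let L := laplacian A.

Let Asym i j : A i j = A j i. Proof. by case: gA. Qed.

Lemma laplacian_sym : L^T = L.
Proof.
apply/matrixP => i j; rewrite !mxE Asym eq_sym.
by case: eqVneq => [->|]//; rewrite !mul0r.
Qed.

(** The Dirichlet energy of the graph; it yields both nonnegativity of the spectrum and the
    description of the kernel. *)
Lemma laplacian_form (x : 'I_n -> R) :
  \sum_i \sum_j x i * L i j * x j = 2^-1 * \sum_i \sum_j A i j * (x i - x j) ^+ 2.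
Proof.
have E1 : \sum_i \sum_j x i * L i j * x j =
    \sum_i \sum_j A i j * x i ^+ 2 - \sum_i \sum_j A i j * (x i * x j).
  rewrite -sumrB; apply: eq_bigr => i _.
  transitivity (\sum_j ((i == j)%:R * (x i * (\sum_k A i k) * x j)
      - A i j * (x i * x j))).
    by apply: eq_bigr => j _; rewrite mxE; ring.
  rewrite sumrB; congr (_ - _); rewrite (bigD1 i)//= eqxx mul1r.
  rewrite [X in _ + X]big1 => [|j]; last by rewrite eq_sym => /negPf ->; rewrite mul0r.
  by rewrite -mulr_suml; ring.
have E2 : \sum_i \sum_j A i j * (x i - x j) ^+ 2 =
   \sum_i \sum_j A i j * x i ^+ 2 + \sum_i \sum_j A i j * x j ^+ 2
   - 2 * \sum_i \sum_j A i j * (x i * x j).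
  rewrite mulr_sumr -big_split/= -sumrB; apply: eq_bigr => i _.
  rewrite mulr_sumr -big_split/= -sumrB; apply: eq_bigr => j _; ring.
have E3 : \sum_i \sum_j A i j * x j ^+ 2 = \sum_i \sum_j A i j * x i ^+ 2.
  rewrite exchange_big/=; apply: eq_bigr => i _; apply: eq_bigr => j _.
  by rewrite Asym.
by rewrite E1 E2 E3; field.
Qed.

Lemma laplacian_form_ge0 (x : 'I_n -> R) : 0 <= \sum_i \sum_j x i * L i j * x j.
Proof.
have [_ A0 _] := gA.
rewrite laplacian_form mulr_ge0 ?invr_ge0//.
by apply: sumr_ge0 => i _; apply: sumr_ge0 => j _; rewrite mulr_ge0 ?sqr_ge0.
Qed.

(** Zero energy forces equal values across every edge of positive weight, hence along every path. *)
Lemma laplacian_ker (x : 'I_n -> R) : connected_graph A ->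
  (forall i, \sum_j L i j * x j = 0) -> forall i j, x i = x j.
Proof.
move=> cA Lx0; have [_ A0 _] := gA.
have F0 : \sum_i \sum_j A i j * (x i - x j) ^+ 2 = 0.
  apply: (mulfI (x := 2^-1)); first by rewrite invr_eq0 pnatr_eq0.
  rewrite -laplacian_form mulr0; apply: big1 => i _.
  under eq_bigr do rewrite -mulrA.
  by rewrite -mulr_sumr Lx0 mulr0.
have edge i j : 0 < A i j -> x i = x j.
  move=> Aij; apply/eqP; rewrite -subr_eq0 -sqrf_eq0.
  rewrite -(mulrI_eq0 _ (lregP (lt0r_neq0 Aij))).
  have /eqP := F0; rewrite psumr_eq0; last first.
    by move=> k _; apply: sumr_ge0 => l _; rewrite mulr_ge0 ?sqr_ge0.
  move=> /allP/(_ i); rewrite mem_index_enum => /(_ isT)/=.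
  rewrite psumr_eq0; last by move=> l _; rewrite mulr_ge0 ?sqr_ge0.
  by move=> /allP/(_ j); rewrite mem_index_enum => /(_ isT)/=.
move=> i j; have /connectP[s] := cA i j.
elim: s i => [i _ ->//|k s IH i /= /andP[ik ks] jE].
by rewrite (edge _ _ ik); exact: IH.
Qed.

Lemma laplacian_sum0 i : \sum_j L i j = 0.
Proof.
rewrite (bigD1 i)//= mxE eqxx mul1r.
rewrite [X in _ + X](eq_bigr (fun j => - A i j)); last first.
  by move=> j ji; rewrite mxE eq_sym (negPf ji) mul0r sub0r.
by rewrite sumrN -addrA -opprD -(bigD1 i (P := xpredT) (F := A i))//= subrr.
Qed.

Variables (S : 'M[R]_n) (d : 'rV[R]_n).
Hypotheses (uS : S \in unitmx) (LS : L = spec_mx S d).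

Let row_eig m : row m S *m L = d 0 m *: row m S.
Proof.
rewrite LS /spec_mx !mulmxA -row_mul mulmxV// row1 -rowE row_diag_mx.
by rewrite -scalemxAl -rowE.
Qed.

Let row_neq0 m : row m S != 0.
Proof.
apply/eqP => r0; have /eqP := congr1 (fun M : 'rV[R]_n => M 0 m) (row_mul m S (invmx S)).
by rewrite /= mulmxV// r0 mul0mx !mxE eqxx oner_eq0.
Qed.

Lemma laplacian_spec_eigenvalue m : eigenvalue L (d 0 m).
Proof. by apply/eigenvalueP; exists (row m S); [exact: row_eig|exact: row_neq0]. Qed.

Lemma laplacian_spec_ge0 m : 0 <= d 0 m.
Proof.
have := laplacian_form_ge0 (fun j => S m j).
have -> : \sum_i \sum_j S m i * L i j * S m j = d 0 m * \sum_j S m j ^+ 2.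
  rewrite exchange_big/= mulr_sumr; apply: eq_bigr => j _.
  rewrite -mulr_suml expr2 mulrA; congr (_ * _).
  have -> : d 0 m * S m j = (d 0 m *: row m S) 0 j by rewrite !mxE.
  by rewrite -row_eig [RHS]mxE; apply: eq_bigr => i _; rewrite [row m S _ _]mxE.
rewrite pmulr_lge0// lt_def sumr_ge0 ?andbT; last by move=> j _; exact: sqr_ge0.
apply: contra (row_neq0 m) => S0; apply/eqP/rowP => j; rewrite !mxE.
move: S0; rewrite psumr_eq0; last by move=> k _; exact: sqr_ge0.
by move=> /allP/(_ j); rewrite mem_index_enum => /(_ isT)/=; rewrite sqrf_eq0 => /eqP.
Qed.

(** Let [P] be the spectral projector onto the kernel. Since [L P = P L = 0], [laplacian_ker] makes
    its columns and rows constant, so all entries are equal. Row sums equal to 1 then fix the common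
    entry at [1 / n], without first proving that the eigenvalue 0 is simple. *)
Lemma centering_spec : connected_graph A ->
  centering R n = spec_mx S (\row_m (d 0 m != 0)%:R).
Proof.
move=> cA; set u := \row_m _.
pose P := spec_mx S (const_mx 1 - u).
have PE : spec_mx S u = 1%:M - P by rewrite /P spec_mxB spec_mx1// subKr.
have LP : L *m P = 0.
  rewrite LS /P spec_mxM// (_ : \row_m _ = 0); first by rewrite /spec_mx linear0 mulmx0 mul0mx.
  by apply/rowP => m; rewrite !mxE; case: eqVneq => [->|]; rewrite ?mul0r// subrr mulr0.
have PL : P *m L = 0.
  rewrite LS /P spec_mxM// (_ : \row_m _ = 0); first by rewrite /spec_mx linear0 mulmx0 mul0mx.
  by apply/rowP => m; rewrite !mxE; case: eqVneq => [->|]; rewrite ?mulr0// subrr mul0r.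
have Pcol i k j : P i j = P k j.
  apply: (laplacian_ker (x := fun l => P l j)) => // l.
  have : (L *m P) l j = 0 by rewrite LP mxE.
  by rewrite mxE.
have Prow i j k : P i j = P i k.
  apply: (laplacian_ker (x := fun l => P i l)) => // l.
  have : (P *m L) i l = 0 by rewrite PL mxE.
  rewrite mxE => E; rewrite -[RHS]E.
  apply: eq_bigr => m _; rewrite mulrC; congr (_ * _).
  by have /matrixP/(_ m l) := laplacian_sym; rewrite mxE.
have P1 i : \sum_j P i j = 1.
  have : (spec_mx S u *m const_mx 1 : 'cV[R]_n) i 0 = 0.
    (* With the convention [0^-1 = 0], the indicator of [d 0 m != 0] factors through [L], which
       kills constant vectors. *)
    rewrite (_ : u = \row_m ((\row_k (d 0 k)^-1) 0 m * d 0 m)); last first.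
      by apply/rowP => m; rewrite !mxE; case: eqVneq => [->|m0]; rewrite ?mulr0// mulVf.
    rewrite -spec_mxM// -LS -mulmxA (_ : L *m const_mx 1 = 0) ?mulmx0 ?mxE//.
    apply/colP => k; rewrite !mxE -[RHS](laplacian_sum0 k).
    by apply: eq_bigr => j _; rewrite [const_mx _ _ _]mxE mulr1.
  rewrite PE mulmxBl mul1mx !mxE => /eqP; rewrite subr_eq0 => /eqP ->.
  by apply: eq_bigr => j _; rewrite [const_mx _ _ _]mxE mulr1.
rewrite PE /centering; congr (_ - _); apply/matrixP => i j.
rewrite [LHS]mxE [const_mx _ _ _]mxE mulr1.
have := P1 i; rewrite (eq_bigr (fun=> P i j)); last by move=> k _; exact: Prow.
rewrite sumr_const card_ord => PN.
have n0 : n%:R != 0 :> R.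
  by rewrite pnatr_eq0 -lt0n (leq_ltn_trans _ (ltn_ord i)).
by apply: (mulIf n0); rewrite mulVf// mulr_natr PN.
Qed.

(** The candidate inverts the nonzero modes and leaves the zero mode at 0. Both products with it are
    the centering matrix, whose symmetry is evident; this gives the symmetry conditions although [S]
    is not known to be orthogonal. *)
Lemma mp_pinv_spec tau : connected_graph A ->
  (forall m, d 0 m != 0 -> sin (tau * d 0 m) != 1) ->
  mp_pinv (centering R n - sinmx (tau *: L)) =
  spec_mx S (\row_m ((d 0 m != 0)%:R / (1 - sin (tau * d 0 m)))).
Proof.
move=> cA sd.
have XE : centering R n - sinmx (tau *: L) =
    spec_mx S (\row_m ((d 0 m != 0)%:R * (1 - sin (tau * d 0 m)))).
  rewrite centering_spec// LS -spec_mxZ sinmx_spec// -spec_mxB; congr spec_mx.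
  apply/rowP => m; rewrite !mxE; case: eqVneq => [->|_] /=.
    by rewrite mulr0 sin0 mul0r subr0.
  by rewrite mul1r.
apply: mp_pinvE; rewrite XE.
pose X := spec_mx S (\row_m ((d 0 m != 0)%:R * (1 - sin (tau * d 0 m)))).
pose Y := spec_mx S (\row_m ((d 0 m != 0)%:R / (1 - sin (tau * d 0 m)))).
have s0 m : d 0 m != 0 -> 1 - sin (tau * d 0 m) != 0.
  by move=> /sd; rewrite subr_eq0 eq_sym.
have XY : X *m Y = centering R n.
  rewrite spec_mxM// centering_spec//; congr spec_mx; apply/rowP => m; rewrite !mxE.
  by case: eqVneq => [_|/s0 m0] /=; rewrite ?mul0r// !mul1r mulfV.
have YX : Y *m X = centering R n.
  rewrite spec_mxM// centering_spec//; congr spec_mx; apply/rowP => m; rewrite !mxE.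
  by case: eqVneq => [_|/s0 m0] /=; rewrite ?mul0r// !mul1r mulVf.
have Msym : (centering R n)^T = centering R n.
  by apply/matrixP => i j; rewrite !mxE eq_sym.
rewrite -/X -/Y; split; rewrite ?XY ?YX//.
- rewrite centering_spec// spec_mxM//; congr spec_mx; apply/rowP => m; rewrite !mxE.
  by case: (_ != _); rewrite /= ?mul0r ?mul1r.
- rewrite centering_spec// spec_mxM//; congr spec_mx; apply/rowP => m; rewrite !mxE.
  by case: (_ != _); rewrite /= ?mul0r ?mul1r.
Qed.

End Laplacian.

(** * Transfer function and performance *)

Lemma integral_lincomb (R : realType) (mu := @lebesgue_measure R) (I : Type)
    (r : seq I) (k : I -> R) (f : I -> R -> R) (v : I -> R) :
  (forall i, mu.-integrable setT (EFin \o f i) /\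
             (\int[mu]_w (f i w)%:E = (v i)%:E)%E) ->
  mu.-integrable setT (EFin \o (fun w => \sum_(i <- r) k i * f i w)) /\
  (\int[mu]_w (\sum_(i <- r) k i * f i w)%:E = (\sum_(i <- r) k i * v i)%:E)%E.
Proof.
move=> fP; elim: r => [|i r [iI vI]].
  rewrite (_ : (fun w => _) = cst 0); last by apply/funext => w; rewrite big_nil.
  split; first exact: integrable0.
  by rewrite big_nil; under eq_integral do rewrite big_nil; rewrite integral0.
have [fi vi] := fP i.
have E : (EFin \o (fun w => \sum_(j <- i :: r) k j * f j w)) =
    (fun w => (k i)%:E * (EFin \o f i) w +
      (EFin \o (fun w => \sum_(j <- r) k j * f j w)%R) w)%E.
  by apply/funext => w; rewrite /= big_cons EFinD EFinM.
have iki : mu.-integrable setT (fun w => (k i)%:E * (EFin \o f i) w)%E.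
  exact: integrableZl.
split; first by rewrite E; exact: integrableD.
rewrite -[X in integral _ _ X]/(EFin \o (fun w => \sum_(j <- i :: r) k j * f j w)).
rewrite E integralD// integralZl// vI big_cons EFinD EFinM.
by rewrite vi.
Qed.

Section TransferFunction.
Variables (R : realType) (n : nat) (A : 'M[R]_n) (tau : R).
Hypothesis gA : undirected_weighted_graph A.
Hypothesis cA : connected_graph A.
Hypothesis tau0 : 0 <= tau.
Let L := laplacian A.
Variables (S : 'M[R]_n) (d : 'rV[R]_n).
Hypotheses (uS : S \in unitmx) (LS : L = spec_mx S d).
Hypothesis dpi : forall m, tau * d 0 m < pi / 2.
Let mu := @lebesgue_measure R.

Let d0 m : 0 <= d 0 m. Proof. exact (laplacian_spec_ge0 gA uS LS m). Qed.

Lemma mode_den_gt0 m w : w != 0 ->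
  0 < w ^+ 2 + d 0 m ^+ 2 - 2 * d 0 m * w * sin (tau * w).
Proof.
move=> w0; have := d0 m; rewrite le_eqVlt => /predU1P[<-|dm].
  by rewrite expr0n/= mulr0 !mul0r addr0 subr0 exprn_even_gt0.
have l0 : d 0 m != 0 by rewrite gt_eqF.
have -> : w ^+ 2 + d 0 m ^+ 2 - 2 * d 0 m * w * sin (tau * w) =
   d 0 m ^+ 2 * delay_quad (tau * d 0 m) (w / d 0 m).
  rewrite /delay_quad (_ : tau * d 0 m * (w / d 0 m) = tau * w); last by field.
  by field.
by rewrite mulr_gt0 ?exprn_gt0// delay_quad_gt0// mulr_ge0// ltW.
Qed.

(** [K = M_n B^-1 L] has eigenvalues [d / b], and being symmetric it satisfies [K^H K = conj(K) K],
    with eigenvalues [mode_gain]. The diagonal intensities on both sides then weight its diagonal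
    entries. At [w = 0] the zero mode makes [B] singular. *)
Lemma trGHG_spec (sigma : 'I_n -> R) w : w != 0 ->
  trGHG (transfer_jw L tau sigma w) =
  \sum_k sigma k ^+ 2 * spec_mx S (\row_m mode_gain (d 0 m) tau w) k k.
Proof.
move=> w0.
pose T := map_mx (real_complex R) S.
have uT : T \in unitmx by rewrite map_unitmx.
pose b m : R[i] := Complex 0 w + expj (- (tau * w)) * (d 0 m)%:C.
have bE m : b m = (d 0 m * cos (tau * w)) +i* (w - d 0 m * sin (tau * w)).
  rewrite /b /expj cosN sinN; apply/eqP; rewrite eq_complex/=.
  by apply/andP; split; apply/eqP; ring.
have b2 m : Re (b m) ^+ 2 + Im (b m) ^+ 2 =
    w ^+ 2 + d 0 m ^+ 2 - 2 * d 0 m * w * sin (tau * w).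
  rewrite bE /=; have cs := cos2Dsin2 (tau * w).
  have -> : (d 0 m * cos (tau * w)) ^+ 2 + (w - d 0 m * sin (tau * w)) ^+ 2 =
    d 0 m ^+ 2 * (cos (tau * w) ^+ 2 + sin (tau * w) ^+ 2) + w ^+ 2
    - 2 * d 0 m * w * sin (tau * w) by ring.
  by rewrite cs mulr1 [_ + w ^+ 2]addrC.
have b0 m : b m != 0.
  have := mode_den_gt0 m w0; rewrite -b2 -normc_sqr exprn_even_gt0//= => bm.
  by rewrite -normc_gt0 lt0r bm normc_ge0.
have LT : cmx L = spec_mx T (map_mx (real_complex R) d).
  by rewrite cmxE LS map_spec_mx.
pose B := Complex 0 w *: 1%:M + expj (- (tau * w)) *: cmx L.
have BT : B = spec_mx T (\row_m b m).
  rewrite /B LT -(spec_mx1 uT) -(spec_mxZ _ (expj _)) -spec_mx_linear; congr spec_mx.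
  by apply/rowP => m; rewrite !mxE mulr1.
have BV : invmx B = spec_mx T (\row_m (b m)^-1).
  have bm0 m : (\row_m b m) 0 m != 0 by rewrite mxE.
  rewrite BT (invmx_spec uT bm0); congr spec_mx.
  by apply/rowP => m; rewrite !mxE.
have MT : cmx (centering R n) = spec_mx T (\row_m (d 0 m != 0)%:R).
  rewrite (centering_spec gA uS LS cA) cmxE map_spec_mx; congr spec_mx.
  by apply/rowP => m; rewrite !mxE rmorph_nat.
have [K KD] : {K : 'M[R[i]]_n | K = spec_mx T (\row_m ((d 0 m)%:C / b m))}.
  by eexists.
have KE : cmx (centering R n) *m invmx B *m cmx L = K.
  rewrite KD MT BV LT !(spec_mxM _ _ uT); congr spec_mx; apply/rowP => m; rewrite !mxE.
  by case: eqVneq => [->|_] /=; rewrite ?mulr0 ?mul0r// mul1r mulrC.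
(* The reversed product is the transpose of [K]; the factors commute, so [K] is symmetric. *)
have KE' : cmx L *m invmx B *m cmx (centering R n) = K.
  rewrite KD MT BV LT !(spec_mxM _ _ uT); congr spec_mx; apply/rowP => m; rewrite !mxE.
  by case: eqVneq => [->|_] /=; rewrite ?mulr1// !mul0r.
have Lsym : (cmx L)^T = cmx L by rewrite cmxE map_trmx (laplacian_sym gA).
have Ksym : K^T = K.
  have Msym : (cmx (centering R n))^T = cmx (centering R n).
    by rewrite cmxE map_trmx; congr map_mx; apply/matrixP => i j; rewrite !mxE eq_sym.
  rewrite -{1}KE !trmx_mul Lsym Msym trmx_inv.
  have -> : B^T = B by rewrite /B linearD/= !linearZ/= Lsym trmx1.
  by rewrite -[RHS]KE' mulmxA.
pose Sg : 'M[R[i]]_n := diag_mx (\row_k Complex (sigma k) 0).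
have GE : transfer_jw L tau sigma w = K *m Sg by rewrite /transfer_jw -/B KE.
have conjT : map_mx (@conjc R) T = T.
  by apply/matrixP => i j; rewrite !mxE conjc_real.
have GH : (map_mx (@conjc R) (K *m Sg))^T =
    Sg *m spec_mx T (\row_m ((d 0 m)%:C / b m)^*%C).
  rewrite map_mxM trmx_mul; congr (_ *m _).
    by apply/matrixP => i j; rewrite !mxE eq_sym; case: eqVneq => [->|_];
      rewrite ?mulr0n ?mulr1n ?conjc0//= oppr0.
  rewrite map_trmx Ksym KD map_spec_mx conjT; congr spec_mx.
  by apply/rowP => m; rewrite !mxE.
have KK : spec_mx T (\row_m ((d 0 m)%:C / b m)^*%C) *m K =
    map_mx (real_complex R) (spec_mx S (\row_m mode_gain (d 0 m) tau w)).
  rewrite KD (spec_mxM _ _ uT) map_spec_mx -/T; congr spec_mx; apply/rowP => m; rewrite !mxE.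
  rewrite mulrC -sqr_normc normrM normfV exprMn exprVn -!add_Re2_Im2 b2 /=.
  by rewrite expr0n addr0 /mode_gain -fmorph_div.
rewrite /trGHG GE GH -mulmxA (mulmxA _ K) KK mulmxA /mxtrace raddf_sum/=.
apply: eq_bigr => k _; move: (spec_mx S _) => E.
rewrite mul_mx_diag mul_diag_mx !mxE /=.
by ring.
Qed.

Lemma integral_spec k :
  mu.-integrable setT
    (EFin \o (fun w => spec_mx S (\row_m mode_gain (d 0 m) tau w) k k)) /\
  (\int[mu]_w (spec_mx S (\row_m mode_gain (d 0 m) tau w) k k)%:E =
   (pi * spec_mx S (\row_m (d 0 m * (cos (tau * d 0 m) / (1 - sin (tau * d 0 m))))) k k)%:E)%E.
Proof.
have [iI vI] := integral_lincomb (index_enum 'I_n)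
  (fun m => invmx S k m * S m k) (fun m => integral_mode_gain (d0 m) tau0 (dpi m)).
have E w : spec_mx S (\row_m mode_gain (d 0 m) tau w) k k =
    \sum_m (invmx S k m * S m k) * mode_gain (d 0 m) tau w.
  by rewrite spec_mxE; apply: eq_bigr => m _; rewrite mxE mulrAC.
split.
  by rewrite (_ : (fun w => _) =
      (fun w => \sum_m (invmx S k m * S m k) * mode_gain (d 0 m) tau w))//;
    apply/funext => w.
under eq_integral do rewrite E.
rewrite vI; congr (_%:E); rewrite spec_mxE mulr_sumr; apply: eq_bigr => m _.
by rewrite mxE; ring.
Qed.

Lemma rho_ss_spec (sigma : 'I_n -> R) : rho_ss L tau sigma =
  \sum_k sigma k ^+ 2 * (2^-1 *
    spec_mx S (\row_m (d 0 m * (cos (tau * d 0 m) / (1 - sin (tau * d 0 m))))) k k).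
Proof.
pose g w := \sum_k sigma k ^+ 2 * spec_mx S (\row_m mode_gain (d 0 m) tau w) k k.
have [iI vI] := integral_lincomb (index_enum 'I_n) (fun k => sigma k ^+ 2) integral_spec.
pose f w := trGHG (transfer_jw L tau sigma w).
have fg : ae_eq mu setT (EFin \o f) (EFin \o g).
  apply: negligibleS (negligible_set1 0) => w /= nw; apply: contrapT => w0; apply: nw.
  by move=> _; rewrite /f trGHG_spec//; apply/eqP.
have mg : measurable_fun setT (EFin \o g) by exact: measurable_int iI.
have mf : measurable_fun setT (EFin \o f).
  apply/measurable_EFinP.
  (* The value of [f] at the excluded frequency 0 is arbitrary; correcting [g] there by an indicator
     proves [f] measurable. *)
  rewrite (_ : f = g \+ (fun w => (f 0 - g 0) * \1_[set 0] w)); last first.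
    apply/funext => w /=; rewrite indicE.
    have [->|w0] := eqVneq w 0; first by rewrite mem_set// mulr1 subrKC.
    by rewrite memNset ?mulr0 ?addr0 /f ?trGHG_spec//; exact/eqP.
  apply: measurable_funD; first exact/measurable_EFinP.
  by apply: measurable_funM.
have fI : (\int[mu]_w (f w)%:E = \int[mu]_w (g w)%:E)%E.
  by apply: ae_eq_integral fg => //; exact: measurableT.
rewrite /rho_ss -/mu fI vI/=.
rewrite mulr_sumr; apply: eq_bigr => k _.
have pi0 : pi != 0 :> R by rewrite gt_eqF// pi_gt0.
move: (spec_mx S _ k k) => e; rewrite invfM mulrCA; congr (_ * _).
by rewrite -mulrA mulKf.
Qed.

End TransferFunction.

Theorem theorem5 (R : realType) (n : nat) (A : 'M[R]_n) (tau : R)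
  (sigma : 'I_n -> R) :
  (0 < n)%N ->
  undirected_weighted_graph A ->
  connected_graph A ->
  0 <= tau ->
  (forall lam : R, eigenvalue (laplacian A) lam -> tau * lam < pi / 2) ->
  (forall k, 0 < sigma k) ->
  forall i : 'I_n,
    is_derive (sigma i ^+ 2) 1
      (fun t : R => rho_ss_var (laplacian A) tau
                      (fun k => if k == i then t else sigma k ^+ 2))
      (2^-1 * (laplacian A *m cosmx (tau *: laplacian A)
               *m mp_pinv (centering R n - sinmx (tau *: laplacian A))) i i).
Proof.
move=> _ gA cA tau0 evpi sigma0 i.
have [S [d [uS LS]]] := real_symmetric_spec (laplacian_sym gA).
have dpi m : tau * d 0 m < pi / 2 by exact/evpi/(laplacian_spec_eigenvalue uS LS).
have d0 m : 0 <= d 0 m := laplacian_spec_ge0 gA uS LS m.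
have sin1 m : sin (tau * d 0 m) < 1 by apply: sin_lt1_pihalf; rewrite ?mulr_ge0.
pose g k := 2^-1 *
  spec_mx S (\row_m (d 0 m * (cos (tau * d 0 m) / (1 - sin (tau * d 0 m))))) k k.
have -> : 2^-1 * (laplacian A *m cosmx (tau *: laplacian A)
    *m mp_pinv (centering R n - sinmx (tau *: laplacian A))) i i = g i.
  rewrite (mp_pinv_spec gA uS LS cA); last by move=> m _; rewrite lt_eqF.
  rewrite {1}LS {1}LS -spec_mxZ cosmx_spec// !spec_mxM//.
  congr (_ * spec_mx S _ i i); apply/rowP => m; rewrite !mxE.
  by case: eqVneq => [->|_] /=; rewrite ?mul0r// mul1r mulrA.
(* The performance is linear in the intensities, hence affine in the [i]-th one with slope [g i];
   [c] collects the other agents. *)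
pose c := \sum_(k | k != i) sigma k ^+ 2 * g k.
have dF : is_derive (sigma i ^+ 2) (1 : R) (fun t : R => g i * t + c) (g i).
  have dg := is_derive_scale (g i) (sigma i ^+ 2).
  rewrite (_ : (fun t => _) = (fun t => g i * t) + cst c)//.
  by apply: is_derive_eq; rewrite addr0.
(* Squaring [Num.sqrt t] returns [t] only for [t >= 0], so the affine formula is used near the
   positive point [sigma i ^+ 2]. *)
apply: near_eq_is_derive dF.
have s2 : 0 < sigma i ^+ 2 by rewrite exprn_gt0.
near=> t.
have t0 : 0 < t by near: t; exact: lt_nbhsr.
rewrite /rho_ss_var (rho_ss_spec gA cA tau0 uS LS dpi) (bigD1 i)//= eqxx.
rewrite sqr_sqrtr ?ltW// [t * _]mulrC; congr (_ + _).
apply: eq_bigr => k ki; rewrite (negPf ki) sqr_sqrtr// sqr_ge0.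
Unshelve. all: by end_near. Qed.
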